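(* Suppose that, for each $n\ge 1$, $\{Y_{n,i},\, 1\le i\le N_n\}$ is a family of random variables with finite moments defined on the same probability space, and let $\Psi_n$ be a positive function on multisets of elements of $[N_n]=\{1,\dots,N_n\}$. Fix a sequence $\mathbf{C}=(C_r)_{r\ge1}$ of positive real numbers, not depending on $n$. Assume that, for each $n$, one has a $(\Psi_n,\mathbf{C})$ weighted dependency graph $\tilde L_n$ for $\{Y_{n,i},\,1\le i\le N_n\}$, and define the quantities $R_n$ and $T_{\ell,n}$ ($\ell\ge1$) by $$R_n=\sum_{\alpha\in[N_n]}\Psi_n(\{\alpha\}),\qquad T_{\ell,n}=\max_{\alpha_1,\dots,\alpha_\ell\in[N_n]}\left[\sum_{\beta\in[N_n]}W(\{\beta\},\{\alpha_1,\dots,\alpha_\ell\})\,\frac{\Psi_n(\{\alpha_1,\dots,\alpha_\ell,\beta\})}{\Psi_n(\{\alpha_1,\dots,\alpha_\ell\})}\right],$$ where $W$ is computed in $\tilde L_n$. Let $X_n=\sum_{i=1}^{N_n}Y_{n,i}$ and $\sigma_n^2=\operatorname{Var}(X_n)$. Assume that there exist numbers $D_r$ ($r\ge1$, not depending on $n$) and $Q_n$ ($n\ge1$), and an integer $s\ge3$, such that $$T_{r,n}\le D_r\,Q_n \quad\text{for all } r,n\ge1,\qquad\text{and}\qquad \left(\frac{R_n}{Q_n}\right)^{1/s}\frac{Q_n}{\sigma_n}\to0\ \text{ as } n\to\infty.$$ Then, in distribution, $\dfrac{X_n-\mathbb{E}X_n}{\sigma_n}\to\mathcal{N}(0,1)$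 as $n\to\infty$.
   Context: All multisets are finite and nonempty. The joint cumulant of random variables $X_1,\dots,X_r$ with finite moments is $\kappa(X_1,\dots,X_r)=\sum_{\pi}(-1)^{\#(\pi)-1}(\#(\pi)-1)!\prod_{C\in\pi}\mathbb{E}\big(\prod_{i\in C}X_i\big)$, the sum being over set partitions $\pi$ of $\{1,\dots,r\}$ and $\#(\pi)$ being the number of blocks; it is symmetric, so $\kappa(Y_\alpha;\alpha\in B)$ makes sense for a multiset $B$. A weighted graph $\tilde L$ is a finite simple graph with a weight in $[0,1]$ on each edge (non-edges can be thought of as edges of weight $0$). For a multiset $B$ of vertices, the induced weighted graph $\tilde L[B]$ has one vertex for each element of $B$ counted with multiplicity; two vertices are joined if the corresponding vertices of $\tilde L$ are equal (then the edge has weight $1$) or joined by an edge in $\tilde L$ (then the edge has the weight of that edge). For a weighted graph $K$, $\mathcal{M}(K)$ is the maximum over spanning trees of $K$ of the product of the weights of the edges of the tree (equal to $1$ if $K$ has one vertex, and to $0$ by convention if $K$ is disconnected). For multisets $I,J$ of vertices of $\tilde L$, $W(I,J)$ is the maximal weight of an edge connecting a vertex of $I$ and a vertex of $J$, with $W(I,J)=1$ if $I\cap J\ne\emptyset$ and $W(I,J)=0$ if $I$ and $J$ are disjoint and no edge joins them. Given a sequence $\mathbf{C}=(C_1,C_2,\dots)$ of positive reals and a real-valued function $\Psi$ on multisets of elements of $A$, a weighted graph $\tilde L$ with vertex set $A$ is a $(\Psi,\mathbf{C})$ weighted dependency graph for a family $\{Y_\alpha,\alpha\in A\}$ of random variables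 (with finite moments, defined on the same probability space) if, for any $r\ge1$ and any multiset $B=\{\alpha_1,\dots,\alpha_r\}$ of elements of $A$, $|\kappa(Y_\alpha;\alpha\in B)|\le C_r\,\Psi(B)\,\mathcal{M}(\tilde L[B])$. *)

(* Defs.v *)
From HB Require Import structures.
From mathcomp Require Import all_boot all_order all_algebra.
From mathcomp Require Import finmap multiset.
From mathcomp Require Import all_classical all_reals all_analysis.
From mathcomp Require Import measurable_realfun.

Set Implicit Arguments.
Unset Strict Implicit.
Unset Printing Implicit Defensive.

Import Order.TTheory GRing.Theory Num.Theory.
Import numFieldNormedType.Exports.

Local Open Scope classical_set_scope.
Local Open Scope ring_scope.

(* Edges are two-element sets of vertices; [wweight] is meaningful on edges
   only. *)
Record wgraph (R : realType) (A : finType) := WGraph {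
  wedges : {set {set A}};
  wweight : {set A} -> R;
  wedges_card : forall e, e \in wedges -> #|e| = 2;
  wweight_itv : forall e, e \in wedges -> 0 <= wweight e <= 1
}.

Section WeightedGraph.
Variable R : realType.

Section Induced.
Variables (A I : finType) (L : wgraph R A) (alpha : I -> A).

Definition induced_edges : {set {set I}} :=
  [set e : {set I} | (#|e| == 2)
                     && ((#|alpha @: e| == 1) || (alpha @: e \in wedges L))].

Definition induced_weight (e : {set I}) : R :=
  if #|alpha @: e| == 1 then 1 else wweight L (alpha @: e).

Lemma induced_edges_card e : e \in induced_edges -> #|e| = 2.
Proof. by rewrite inE => /andP[/eqP]. Qed.

Lemma induced_weight_itv e : e \in induced_edges -> 0 <= induced_weight e <= 1.
Proof.
rewrite inE /induced_weight => /andP[_]; case: ifP => _ /=.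
  by rewrite ler01 lexx.
exact: wweight_itv.
Qed.

(* The induced weighted graph on the multiset listed (with repetitions) by the
   family [alpha]: one vertex per index [i : I]. *)
Definition induced : wgraph R I :=
  WGraph induced_edges_card induced_weight_itv.

End Induced.

Definition adj (V : finType) (E : {set {set V}}) : rel V :=
  fun x y => [set x; y]%SET \in E.

(* [ucycle] admits the empty cycle and, for adjacent [x] and [y], the degenerate
   cycle [:: x; y]; genuine cycles of a simple graph have at least 3 vertices. *)
Definition is_spanning_tree (V : finType) (K : wgraph R V) (E : {set {set V}}) :=
  [/\ E \subset wedges K,
      forall x y, connect (adj E) x y
    & forall c : seq V, ucycle (adj E) c -> (size c < 3)%N].

(* Weights are nonnegative, so 0 as the unit of [Num.max] only matters when
   there is no spanning tree. *)
Definition max_spanning_weight (V : finType) (K : wgraph R V) : R :=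
  \big[Num.max/0]_(E : {set {set V}} | `[< is_spanning_tree K E >])
    \prod_(e in E) wweight K e.

Definition Wmax (A : finType) (L : wgraph R A) (I J : {mset A}%mset) : R :=
  if [exists x : A, (x \in I) && (x \in J)] then 1
  else \big[Num.max/0]_(p : A * A | [&& p.1 \in I, p.2 \in J
                                      & adj (wedges L) p.1 p.2])
         wweight L [set p.1; p.2]%SET.

End WeightedGraph.

Section Cumulants.
Context d (T : measurableType d) (R : realType) (P : probability T R).

(* For X_i with finite moments the expectations below are finite, so that [fine]
   loses nothing. *)
Definition joint_cumulant (I : finType) (X : I -> T -> R) : R :=
  \sum_(pi : {set {set I}} | finset.partition pi [set: I]%SET)
    (-1) ^+ #|pi|.-1 * (#|pi|.-1)`!%:R *
    \prod_(C in pi) fine 'E_P[fun w => \prod_(i in C) X i w].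

(* Absolute moments are meant: integrability of X^k is that of |X|^k. *)
Definition finite_moments (X : T -> R) :=
  forall k : nat, P.-integrable [set: T] (fun w => (X w ^+ k)%:E).

(* The multiset B is listed by the tuple [alpha]; both sides are invariant under
   permutations of [alpha]. *)
Definition weighted_dependency_graph (A : finType) (Psi : {mset A}%mset -> R)
    (C : nat -> R) (L : wgraph R A) (Y : A -> {RV P >-> R}) :=
  forall (r : nat) (alpha : r.-tuple A), (0 < r)%N ->
    `|joint_cumulant (fun i : 'I_r => Y (tnth alpha i))|
      <= C r * Psi (seq_mset alpha) * max_spanning_weight (induced L (tnth alpha)).

Definition standard_deviation (X : T -> R) : R := Num.sqrt (fine 'V_P[X]).

Definition standardize (X : {RV P >-> R}) : {RV P >-> R} :=
  (standard_deviation X)^-1 *: (X - cst (fine 'E_P[X])).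

End Cumulants.

Section RT.
Variables (R : realType) (A : finType) (Psi : {mset A}%mset -> R).

Definition Rsum : R := \sum_(a : A) Psi [mset a]%mset.

(* The terms are nonnegative for positive [Psi], so for nonempty [A] the unit 0
   of [Num.max] does not affect the maximum. *)
Definition Tmax (L : wgraph R A) (l : nat) : R :=
  \big[Num.max/0]_(alpha : l.-tuple A)
    \sum_(b : A) Wmax L [mset b]%mset (seq_mset alpha) *
      (Psi (b +` seq_mset alpha)%mset / Psi (seq_mset alpha)).

End RT.

Definition cvg_in_distribution (R : realType) (d : nat -> measure_display)
    (T : forall n, measurableType (d n)) (P : forall n, probability (T n) R)
    (Z : forall n, {RV (P n) >-> R}) (mu : probability (measurableTypeR R) R) :=
  forall x : R, {for x, continuous (fun t : R => mu `]-oo, t]%classic)} ->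
    cdf (Z n) x @[n --> \oo] --> mu `]-oo, x]%classic.

(* Main.v *)
Require Import Defs.
From HB Require Import structures.
From mathcomp Require Import all_boot all_order all_algebra.
From mathcomp Require Import finmap multiset.
From mathcomp Require Import all_classical all_reals all_analysis.
From mathcomp Require Import measurable_realfun.
From mathcomp Require Import ring lra.

(** Write k_r for the cumulant of order r of the sum X_n, sigma for its standard
    deviation, and put a = R_n / Q_n, q = Q_n / sigma.

    Joint cumulants are multilinear, so k_r is the sum of the joint cumulants of
    (Y_alpha1, ..., Y_alphar) over all r-tuples ([joint_cumulant_sum]), each of which is
    controlled by a maximal spanning tree.  Exploring such a tree from a vertex attaches
    the other vertices one at a time, each through a tree edge whose weight is at most
    the W between the new vertex and the earlier ones ([connected_ordering]).  Summing
    over the vertex attached last, then over the one before, and so on, produces the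
    factors T_(r-1), ..., T_1 and finally R ([dependency_sum_le]).  Hence
    |k_r| <= c_r R_n Q_n^(r-1) ([cumulant_sum_le_power]), which says that the
    standardized cumulant of order r >= 2 is at most c_r a q^r.  By hypothesis a q^s tends
    to 0, whereas c_2 a q^2 is at least the standardized variance, which is 1; therefore
    q <= 1 eventually and the standardized cumulants of all orders r >= s tend to 0.

    The orders 3, ..., s-1 cannot be estimated in this way.  They are handled as in
    Janson's theorem ([janson_cumulants]): rescale so that they become bounded and pass
    to a limit along an ultrafilter.  The limiting moments form a positive sequence with
    only finitely many nonzero cumulants, and Marcinkiewicz's theorem ([marcinkiewicz])
    says that only the first two survive.  It is proved here for moment sequences, with no
    limiting measure: if f(z) is the sum of the m_n z^n / n!, then f = exp P with P a
    polynomial ([modulus_series]), positivity of the moment functional on squares gives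
    |f(z)| <= f(Re z) ([log_modulus_ridge]), hence Re P(z) <= P(Re z), and this is violated
    far away on a suitable ray through 0 as soon as P has degree at least 3.

    So all standardized cumulants converge to those of the normal law, and the
    moment-cumulant recursion turns this into convergence of moments ([cvg_moments]).
    Taylor's formula with remainder then yields the convergence of the expectation of every
    trigonometric polynomial ([cvg_expectation_trig]).  The indicator of a half-line is
    squeezed between trigonometric polynomials up to a small shift and a small multiple
    of 1 + z^2 ([trig_step]); as the second moments are bounded, the distribution
    functions converge at every continuity point ([cvg_normal_of_moments]). *)

Set Implicit Arguments.
Unset Strict Implicit.
Unset Printing Implicit Defensive.

Import Order.TTheory GRing.Theory Num.Theory.
Import numFieldNormedType.Exports.

Local Open Scope classical_set_scope.
Local Open Scope ring_scope.

(** * Entire power series *)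

Lemma cvg_sumr (R : realType) (T I : Type) (F : set_system T) {FF : Filter F}
    (r : seq I) (P : pred I) (f : I -> T -> R) (l : I -> R) :
    (forall j, P j -> f j x @[x --> F] --> l j) ->
  \sum_(j <- r | P j) f j x @[x --> F] --> \sum_(j <- r | P j) l j.
Proof. by move=> h; apply: cvg_big => //; exact: add_continuous. Qed.

Lemma natr_bin (R : numFieldType) n j : (j <= n)%N ->
  'C(n, j)%:R = n`!%:R / (j`!%:R * (n - j)`!%:R) :> R.
Proof.
by move=> jn; rewrite -(bin_fact jn) !natrM mulfK// -natrM pnatr_eq0
  -lt0n muln_gt0 !fact_gt0.
Qed.

Section EntireMomentSeries.
Variable R : realType.
Implicit Types (a u c e : nat -> R) (x t : R).

(** Infinite radius of convergence, in a form that passes easily through bounded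
    multipliers, derivatives and recursions. *)
Definition entire_coef c :=
  forall B, 0 <= B -> exists M, forall n, `|c n| * B ^+ n <= M.

Lemma cvg_pseries_entire c x : entire_coef c -> cvgn (pseries c x).
Proof.
move=> hc; have [M hM] := hc (2 * `|x|) (mulr_ge0 (ler0n _ 2) (normr_ge0 _)).
apply: normed_cvg.
apply: (@series_le_cvg _ _ (geometric M 2^-1)) => //=.
- by move=> n; rewrite mulr_ge0 ?exprn_ge0 ?invr_ge0// (le_trans _ (hM 0%N))//
    mulr_ge0 ?exprn_ge0.
- move=> n; have := hM n; rewrite exprMn normrM normrX => h.
  rewrite exprVn ler_pdivlMr ?exprn_gt0//; apply: le_trans h; rewrite le_eqVlt; apply/orP;
    left; apply/eqP; ring.
- by apply: is_cvg_geometric_series; rewrite ger0_norm ?invr_ge0// invf_lt1 ?ltr1n.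
Qed.

Lemma entire_coefM c e :
  entire_coef c -> (forall n, `|e n| <= 1) -> entire_coef (fun n => c n * e n).
Proof.
move=> hc he B B0; have [M hM] := hc B B0; exists M => n.
apply: le_trans (hM n); rewrite ler_wpM2r ?exprn_ge0// normrM ler_piMr//.
Qed.

Lemma entire_coef_diffs c : entire_coef c -> entire_coef (pseries_diffs c).
Proof.
move=> hc B B0; have [M hM] := hc (2 * (B + 1)) (mulr_ge0 (ler0n _ 2) (addr_ge0 B0 ler01)).
exists M => n; apply: le_trans (hM n.+1).
rewrite /pseries_diffs normrM normr_nat -mulrA mulrCA ler_wpM2l// exprMn.
have B1 : B <= B + 1 by rewrite lerDl.
apply: ler_pM; rewrite ?exprn_ge0//.
  by rewrite -natrX ler_nat ltnW// ltn_expl.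
rewrite exprS -[leLHS]mul1r ler_pM ?exprn_ge0//; first by rewrite lerDr.
by rewrite lerXn2r ?nnegrE// addr_ge0.
Qed.

Lemma limn_pseries_shift e x j :
    cvgn (pseries e x) ->
  pseries (fun n => if (n < j)%N then 0 else e (n - j)%N) x @ \oo -->
    x ^+ j * limn (pseries e x).
Proof.
move=> ce; rewrite -(cvg_shiftn j).
have -> : (fun n => pseries (fun n => if (n < j)%N then 0 else e (n - j)%N) x (n + j)%N) =
    (fun n => x ^+ j * pseries e x n).
  apply/funext => n; rewrite /pseries /series /= addnC (big_cat_nat (n := j)) ?leq_addr//=.
  rewrite big_nat_cond big1 ?add0r; last first.
    by move=> i /andP[/andP[_ ->] _]; rewrite mul0r.
  rewrite -{1}[j]add0n big_addn addKn mulr_sumr; apply: eq_bigr => i _.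
  by rewrite ltnNge leq_addl/= addnK exprD; ring.
exact: cvgMl_tmp.
Qed.

(** Multiplication of a power series by the polynomial with coefficients [a]: a
    finite sum of shifted copies of the series, each of which converges with it. *)
Lemma limn_pseries_conv a e x d :
    (forall j, (d <= j)%N -> a j = 0) -> cvgn (pseries e x) ->
  pseries (fun n => \sum_(j < n.+1) a j * e (n - j)%N) x @ \oo -->
    \sum_(j < d) a j * x ^+ j * limn (pseries e x).
Proof.
move=> a0 ce.
have -> : pseries (fun n => \sum_(j < n.+1) a j * e (n - j)%N) x =
  (fun N => \sum_(j < d) a j * pseries (fun n => if (n < j)%N then 0 else e (n - j)%N) x N).
  apply/funext => N; rewrite /pseries /series /=.
  under [RHS]eq_bigr do rewrite mulr_sumr.
  rewrite exchange_big /=; apply: eq_bigr => n _.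
  under [RHS]eq_bigr do rewrite mulrA.
  rewrite -mulr_suml; congr (_ * _).
  transitivity (\sum_(j < n.+1 + d | (j < n.+1)%N) a j * e (n - j)%N).
    by rewrite (big_ord_widen _ (fun j => a j * e (n - j)%N) (leq_addr d n.+1)).
  rewrite [RHS](big_ord_widen _ (fun j => a j * (if (n < j)%N then 0 else e (n - j)%N))
    (leq_addl n.+1 d)).
  rewrite big_mkcond [RHS]big_mkcond; apply: eq_bigr => j _.
  case: (ltnP j d) => jd; last by rewrite a0// mul0r if_same.
  by rewrite ltnS; case: leqP => //; rewrite mulr0.
apply: cvg_sumr => j _; rewrite -mulrA; apply: cvgMl_tmp.
exact: limn_pseries_shift.
Qed.

(** The recursion is the coefficient form of u' = a u with [a] a polynomial.  As soon
    as n + 1 exceeds the sum of the |a_j| B^(j+1), it bounds |u_(n+1)| B^(n+1) by the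
    largest of the earlier values of |u_j| B^j. *)
Lemma entire_conv_recursion a u d :
    (forall j, (d <= j)%N -> a j = 0) ->
    (forall n, n.+1%:R * u n.+1 = \sum_(j < n.+1) a j * u (n - j)%N) ->
  entire_coef u.
Proof.
move=> a0 hu B B0.
pose A := \sum_(j < d) `|a j| * B ^+ j.+1.
have A0 : 0 <= A by apply: sumr_ge0 => j _; rewrite mulr_ge0 ?exprn_ge0.
pose K := (Num.truncn A).+1; have AK : A < K%:R by exact: truncnS_gt.
pose C := \sum_(i < K) `|u i| * B ^+ i.
have C0 : 0 <= C by apply: sumr_ge0 => j _; rewrite mulr_ge0 ?exprn_ge0.
exists C; elim/ltn_ind => n IH.
have [nK|Kn] := ltnP n K.
  rewrite /C (bigD1 (Ordinal nK))//= lerDl sumr_ge0// => j _.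
  by rewrite mulr_ge0 ?exprn_ge0.
case: n IH Kn => [//|n] IH Kn.
have n1 : 0 < n.+1%:R :> R by rewrite ltr0n.
rewrite -(ler_pM2l n1) mulrA -{1}(gtr0_norm n1) -normrM hu.
apply: (@le_trans _ _ (\sum_(j < n.+1) `|a j| * B ^+ j.+1 * C)).
  apply: (@le_trans _ _ ((\sum_(j < n.+1) `|a j * u (n - j)%N|) * B ^+ n.+1)).
    by rewrite ler_wpM2r ?exprn_ge0// ler_norm_sum.
  rewrite mulr_suml; apply: ler_sum => j _.
  have -> : B ^+ n.+1 = B ^+ j.+1 * B ^+ (n - j) by rewrite -exprD addSn subnKC// -ltnS.
  rewrite normrM mulrACA ler_wpM2l ?mulr_ge0 ?exprn_ge0//.
  by apply: IH; rewrite ltnS leq_subr.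
rewrite -mulr_suml ler_wpM2r//; apply: le_trans (_ : A <= _); last first.
  by rewrite (le_trans (ltW AK))// ler_nat.
rewrite /A (big_ord_widen _ (fun j => `|a j| * B ^+ j.+1) (leq_addr d n.+1)).
rewrite (big_ord_widen _ (fun j => `|a j| * B ^+ j.+1) (leq_addl n.+1 d)).
rewrite big_mkcond [leRHS]big_mkcond; apply: ler_sum => j _.
case: (ltnP j d) => jd; first by case: ifP => // _; rewrite mulr_ge0 ?exprn_ge0.
by rewrite a0// normr0 mul0r; case: ifP.
Qed.

End EntireMomentSeries.

(** * Modulus of a power series with polynomial logarithm *)

Section MarcinkiewiczModulus.
Variables (R : realType) (a u : nat -> R) (d : nat).
Hypothesis a_tail : forall j, (d <= j)%N -> a j = 0.
Hypothesis u0 : u 0%N = 1.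
Hypothesis u_rec :
  forall n, n.+1%:R * u n.+1 = \sum_(j < n.+1) a j * u (n - j)%N.

Let u_entire : entire_coef u. Proof. exact: (entire_conv_recursion a_tail u_rec). Qed.

(** [cos_series th x] and [sin_series th x] are the real and imaginary parts of
    f(x e^(i th)), where f is the power series with coefficients [u]. *)
Definition cos_series th x := limn (pseries (fun n => u n * cos (n%:R * th)) x).
Definition sin_series th x := limn (pseries (fun n => u n * sin (n%:R * th)) x).

(** The real part of P(x e^(i th)), as a polynomial in x, where P is the primitive of
    the polynomial with coefficients [a] that vanishes at 0; thus f = exp P. *)
Definition log_modulus th : {poly R} :=
  \poly_(i < d.+1) (if i is j.+1 then a j / j.+1%:R * cos (j.+1%:R * th) else 0).

Lemma entire_cos th : entire_coef (fun n => u n * cos (n%:R * th)).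
Proof. by apply: entire_coefM => // n; exact: cos_max. Qed.

Lemma entire_sin th : entire_coef (fun n => u n * sin (n%:R * th)).
Proof. by apply: entire_coefM => // n; exact: sin_max. Qed.

Lemma is_derive_pseries_entire (c : nat -> R) (x : R) : entire_coef c ->
  is_derive x (1 : R) (fun x => limn (pseries c x)) (limn (pseries (pseries_diffs c) x)).
Proof.
move=> hc; have hc1 := entire_coef_diffs hc; have hc2 := entire_coef_diffs hc1.
apply: (@pseries_snd_diffs _ c (`|x| + 1) x);
  rewrite ?[X in _ < X]ger0_norm ?addr_ge0 ?ltrDl//; exact: cvg_pseries_entire.
Qed.

Let angleD n (th : R) j : (j <= n)%N -> n.+1%:R * th = j.+1%:R * th + (n - j)%:R * th.
Proof. by move=> jn; rewrite -mulrDl -natrD addSn subnKC. Qed.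

(** Real part of the equation f' = P' f along the ray of angle [th]. *)
Lemma is_derive_cos_series th (x : R) :
  is_derive x (1 : R) (cos_series th)
    ((\sum_(j < d) a j * cos (j.+1%:R * th) * x ^+ j) * cos_series th x
   - (\sum_(j < d) a j * sin (j.+1%:R * th) * x ^+ j) * sin_series th x).
Proof.
apply: is_derive_eq; first exact: is_derive_pseries_entire (entire_cos th).
apply: cvg_lim => //.
rewrite [X in X @ _](_ : _ =
  pseries (fun n => \sum_(j < n.+1) a j * cos (j.+1%:R * th) *
     (u (n - j)%N * cos ((n - j)%:R * th))) x -
  pseries (fun n => \sum_(j < n.+1) a j * sin (j.+1%:R * th) *
     (u (n - j)%N * sin ((n - j)%:R * th))) x); last first.
  apply/funext => N; rewrite /pseries /series /= fctE -sumrB; apply: eq_bigr => n _.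
  rewrite -mulrBl; congr (_ * _); rewrite /pseries_diffs mulrA u_rec mulr_suml -sumrB.
  apply: eq_bigr => j _; rewrite (@angleD n th j) ?cosD; last by rewrite -ltnS.
  by ring.
rewrite !mulr_suml; apply: cvgB.
- apply: (@limn_pseries_conv _ (fun j => a j * cos (j.+1%:R * th)) (fun n => u n
    * cos (n%:R * th))) => [j jd|].
    by rewrite a_tail ?mul0r.
  exact: cvg_pseries_entire (entire_cos th).
- apply: (@limn_pseries_conv _ (fun j => a j * sin (j.+1%:R * th)) (fun n => u n
    * sin (n%:R * th))) => [j jd|].
    by rewrite a_tail ?mul0r.
  exact: cvg_pseries_entire (entire_sin th).
Qed.

(** Imaginary part of the equation f' = P' f along the ray of angle [th]. *)
Lemma is_derive_sin_series th (x : R) :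
  is_derive x (1 : R) (sin_series th)
    ((\sum_(j < d) a j * cos (j.+1%:R * th) * x ^+ j) * sin_series th x
   + (\sum_(j < d) a j * sin (j.+1%:R * th) * x ^+ j) * cos_series th x).
Proof.
apply: is_derive_eq; first exact: is_derive_pseries_entire (entire_sin th).
apply: cvg_lim => //.
rewrite [X in X @ _](_ : _ =
  pseries (fun n => \sum_(j < n.+1) a j * cos (j.+1%:R * th) *
     (u (n - j)%N * sin ((n - j)%:R * th))) x +
  pseries (fun n => \sum_(j < n.+1) a j * sin (j.+1%:R * th) *
     (u (n - j)%N * cos ((n - j)%:R * th))) x); last first.
  apply/funext => N; rewrite /pseries /series /= fctE -big_split; apply: eq_bigr => n _ /=.
  rewrite -mulrDl; congr (_ * _); rewrite /pseries_diffs mulrA u_rec mulr_suml -big_split.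
  apply: eq_bigr => j _ /=; rewrite (@angleD n th j) ?sinD; last by rewrite -ltnS.
  by ring.
rewrite !mulr_suml; apply: cvgD.
- apply: (@limn_pseries_conv _ (fun j => a j * cos (j.+1%:R * th)) (fun n => u n
    * sin (n%:R * th))) => [j jd|].
    by rewrite a_tail ?mul0r.
  exact: cvg_pseries_entire (entire_sin th).
- apply: (@limn_pseries_conv _ (fun j => a j * sin (j.+1%:R * th)) (fun n => u n
    * cos (n%:R * th))) => [j jd|].
    by rewrite a_tail ?mul0r.
  exact: cvg_pseries_entire (entire_cos th).
Qed.

Lemma deriv_log_modulus th x :
  ((log_modulus th)^`()).[x] = \sum_(j < d) a j * cos (j.+1%:R * th) * x ^+ j.
Proof.
have -> : (log_modulus th)^`() = \poly_(j < d) (a j * cos (j.+1%:R * th)).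
  apply/polyP => j; rewrite coef_deriv !coef_poly ltnS; case: ifP => _;
    last by rewrite mul0rn.
  by rewrite -[LHS]mulr_natr -!mulrA; congr (_ * _);
    rewrite mulrCA mulVf ?mulr1// pnatr_eq0.
by rewrite horner_poly.
Qed.

Lemma limn_pseries0 (c : nat -> R) : limn (pseries c 0) = c 0%N.
Proof.
apply: cvg_lim => //; rewrite -cvg_shiftS /=.
rewrite (_ : (fun n => _) = cst (c 0%N)); first exact: cvg_cst.
apply/funext => n; rewrite /pseries /series /= big_nat_recl// expr0 mulr1 big1 ?addr0//.
by move=> i _; rewrite expr0n /= mulr0.
Qed.

(** In y = |f|^2 the rotating part of f' = P' f cancels: y' = 2 q' y with
    q = [log_modulus th], and y = 1 at the origin. *)
Lemma modulus_series th x :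
  cos_series th x ^+ 2 + sin_series th x ^+ 2 = expR (2 * (log_modulus th).[x]).
Proof.
pose G y := (cos_series th y ^+ 2 + sin_series th y ^+ 2)
  * expR (- 2 * (log_modulus th).[y]).
have G1 : G x = G 0.
  apply: is_derive_0_is_cst => y.
  pose A := \sum_(j < d) a j * cos (j.+1%:R * th) * y ^+ j.
  pose B := \sum_(j < d) a j * sin (j.+1%:R * th) * y ^+ j.
  have dc := is_derive_cos_series th y; have ds := is_derive_sin_series th y.
  have dp : is_derive y (1 : R) (fun y => -2 * (log_modulus th).[y]) (-2 * A).
    by rewrite /A -deriv_log_modulus; apply: is_deriveZ.
  have de : is_derive y (1 : R) (fun y => expR (-2 * (log_modulus th).[y]))
    ( expR (-2 * (log_modulus th).[y]) * (-2 * A)).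
    exact: (@is_derive1_comp _ expR _ _ _ _ (is_derive_expR _) dp).
  have d2 := is_deriveD (is_deriveX 2 dc) (is_deriveX 2 ds).
  have dG : is_derive y (1 : R) G _ := is_deriveM d2 de.
  apply: (is_derive_eq dG).
  by rewrite /GRing.scale /= -/A -/B !fctE /=; ring.
have : G 0 = 1.
  rewrite /G /cos_series /sin_series !limn_pseries0 !mul0r cos0 sin0 u0 horner_coef0
    coef_poly /=.
  by rewrite !mulr0 expR0; ring.
rewrite -G1 /G mulNr expRN => h; apply: (mulIf
  (invr_neq0 (lt0r_neq0 (expR_gt0 (2 * (log_modulus th).[x]))))).
by rewrite h divff// gt_eqF ?expR_gt0.
Qed.

End MarcinkiewiczModulus.

(** * Positivity on squares of trigonometric expansions *)

(** Real part of the binomial expansion of e^(i ps) (e^(i th) + e^(-i th))^n.  The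
    phase [ps] is what lets the induction on [n] close, by Pascal's rule. *)
Lemma sum_bin_cos (R : realType) (th ps : R) n :
  \sum_(j < n.+1) 'C(n, j)%:R * cos (j%:R * th - (n - j)%:R * th + ps) =
  2 ^+ n * cos th ^+ n * cos ps.
Proof.
elim: n ps => [|n IH] ps.
  by rewrite big_ord_recl big_ord0 bin0 /= subnn !mul0r subr0 add0r addr0 !expr0 mulr1.
have -> : 2 ^+ n.+1 * cos th ^+ n.+1 * cos ps =
    2 ^+ n * cos th ^+ n * cos (ps + th) + 2 ^+ n * cos th ^+ n * cos (ps - th).
  by rewrite !exprS !cosD cosN sinN; ring.
rewrite -!IH big_ord_recl /= bin0 subn0.
have -> : \sum_(i < n.+1) 'C(n.+1, bump 0 i)%:R
  * cos ((bump 0 i)%:R * th - (n.+1 - bump 0 i)%:R * th + ps)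
  = \sum_(i < n.+1) 'C(n, i.+1)%:R * cos ((i.+1)%:R * th - (n - i)%:R * th + ps)
   + \sum_(i < n.+1) 'C(n, i)%:R * cos (i%:R * th - (n - i)%:R * th + (ps + th)).
  rewrite -big_split /=; apply: eq_bigr => i _.
  rewrite /bump /= add1n subSS binS natrD mulrDl; congr (_ + _ * cos _).
  by rewrite -[i.+1]addn1 natrD; ring.
rewrite addrA [RHS]addrC; congr (_ + _).
rewrite [RHS]big_ord_recl /= bin0 subn0 big_ord_recr /= bin_small//.
rewrite [X in _ + (_ + X)]mul0r addr0.
congr (_ + _).
  by congr (_ * cos _); rewrite -[n.+1]addn1 natrD; ring.
apply: eq_bigr => i _; rewrite /bump /= add1n; congr (_ * cos _).
have -> : (n - i)%:R = (n - i.+1)%:R + 1 :> R.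
  by rewrite subnS natr1 prednK// subn_gt0.
by ring.
Qed.

(** Positive semidefiniteness of the Hankel forms of [m], that is, positivity on
    squares of the linear functional sending x^n to [m n]. *)
Definition moment_positive (R : realType) (m : nat -> R) :=
  forall (N : nat) (c : nat -> R),
    0 <= \sum_(i < N) \sum_(j < N) c i * c j * m (i + j)%N.

Lemma moment_form_poly (R : realType) (m c : nat -> R) N :
  let p := \poly_(i < N) c i in
  \sum_(i < N) \sum_(j < N) c i * c j * m (i + j)%N =
  \sum_(0 <= n < N + N) (p * p)`_n * m n.
Proof.
rewrite /= big_mkord poly_def mulr_suml.
transitivity (\sum_(n < N + N) \sum_(i < N) \sum_(j < N)
    c i * c j * ((nat_of_ord n == (i + j)%N)%:R * m n)).
  rewrite [RHS]exchange_big; apply: eq_bigr => i _.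
  rewrite [RHS]exchange_big; apply: eq_bigr => j _ /=.
  rewrite -mulr_sumr; congr (_ * _).
  have ijN : (i + j < N + N)%N by rewrite -addnS leq_add// ltnW.
  rewrite (bigD1 (Ordinal ijN))//= eqxx mul1r big1 ?addr0// => n /eqP nij.
  by case: eqP => [nE|_]; rewrite ?mul0r//; case: nij; exact: val_inj.
apply: eq_bigr => n _; rewrite coef_sum mulr_suml; apply: eq_bigr => i _.
rewrite mulr_sumr coef_sum mulr_suml; apply: eq_bigr => j _.
have -> : c i *: 'X^i * (c j *: 'X^j) = (c i * c j) *: 'X^(i + j) :> {poly R}.
  by rewrite -scalerAl -scalerAr scalerA -exprD.
by rewrite coefZ coefXn mulrA.
Qed.

Lemma sum_bin (R : pzSemiRingType) n : \sum_(j < n.+1) 'C(n, j)%:R = 2 ^+ n :> R.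
Proof.
rewrite -natr_sum -natrX -[2%N]/(1 + 1)%N expnDn; congr (_%:R).
by apply: eq_bigr => i _; rewrite !exp1n !muln1.
Qed.

Section TrigSquares.
Variables (R : realType) (al be th rho : R).

Let x (j : nat) : R :=
  (al * cos (j%:R * th) + be * sin (j%:R * th)) * (rho / 2) ^+ j / j`!%:R.

(** The [x j] are the coefficients of al Re w + be Im w, where
    w = exp(rho e^(i th) X / 2).  Since w^2 = exp(rho e^(i th) X) and
    |w|^2 = exp(rho cos(th) X), the square of al Re w + be Im w is one half of
    (al^2 - be^2) Re w^2 + 2 al be Im w^2 + (al^2 + be^2) |w|^2; this is that identity,
    coefficient by coefficient. *)
Lemma trig_square_coef n :
  \sum_(j < n.+1) x j * x (n - j)%N =
  rho ^+ n / n`!%:R *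
   (((al ^+ 2 - be ^+ 2) * cos (n%:R * th) + 2 * al * be * sin (n%:R * th)
     + (al ^+ 2 + be ^+ 2) * cos th ^+ n) / 2).
Proof.
have := sum_bin_cos th 0 n; rewrite cos0 mulr1 => sumcos.
transitivity (\sum_(j < n.+1) (rho / 2) ^+ n / n`!%:R *
   ('C(n, j)%:R * (((al ^+ 2 - be ^+ 2) * cos (n%:R * th) + 2 * al * be * sin (n%:R * th))
     / 2)
    + (al ^+ 2 + be ^+ 2) / 2 * ('C(n, j)%:R * cos (j%:R * th - (n - j)%:R * th + 0)))).
  apply: eq_bigr => j _; have jn : (j <= n)%N by rewrite -ltnS.
  have nth : n%:R * th = j%:R * th + (n - j)%:R * th by rewrite -mulrDl -natrD subnKC.
  have -> : (rho / 2) ^+ n = (rho / 2) ^+ j * (rho / 2) ^+ (n - j) by rewrite -exprD subnKC.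
  have f0 k : k`!%:R != 0 :> R by rewrite pnatr_eq0 -lt0n fact_gt0.
  rewrite /x addr0 natr_bin// nth cosD cosD sinD cosN sinN.
  by field; rewrite !f0.
rewrite -mulr_sumr big_split /= -mulr_suml -mulr_sumr sum_bin sumcos.
rewrite expr_div_n; field.
by rewrite pnatr_eq0 -lt0n fact_gt0 expf_neq0.
Qed.

Lemma trig_square_coef_le (K n : nat) :
  `|((\poly_(j < K) x j) * (\poly_(j < K) x j))`_n| <=
  (`|al| + `|be|) ^+ 2 * (`|rho| ^+ n / n`!%:R).
Proof.
pose A := `|al| + `|be|.
have A0 : 0 <= A by rewrite addr_ge0.
have xle j : `|x j| <= A * ((`|rho| / 2) ^+ j / j`!%:R).
  rewrite /x -mulrA normrM ler_pM//.
    rewrite (le_trans (ler_normD _ _))// !normrM lerD// ler_piMr// ?cos_max//.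
    exact: sin_max.
  by rewrite normrM normfV normr_nat normrX normrM normfV normr_nat.
have yle j : `|(\poly_(j < K) x j)`_j| <= A * ((`|rho| / 2) ^+ j / j`!%:R).
  rewrite coef_poly; case: ifP => _ //; rewrite normr0 mulr_ge0 ?mulr_ge0 ?exprn_ge0
    ?invr_ge0//.
rewrite coefM (le_trans (ler_norm_sum _ _ _))//.
apply: (@le_trans _ _ (\sum_(j < n.+1) A ^+ 2 * ((`|rho| / 2) ^+ n / n`!%:R)
  * 'C(n, j)%:R)).
  apply: ler_sum => j _; have jn : (j <= n)%N by rewrite -ltnS.
  rewrite normrM (le_trans (ler_pM _ _ (yle _) (yle _)))//.
  have -> : (`|rho| / 2) ^+ n = (`|rho| / 2) ^+ j * (`|rho| / 2) ^+ (n - j) by rewrite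
    -exprD subnKC.
  have f0 k : k`!%:R != 0 :> R by rewrite pnatr_eq0 -lt0n fact_gt0.
  rewrite natr_bin// le_eqVlt; apply/orP; left; apply/eqP.
  by field; rewrite !f0.
rewrite -mulr_sumr sum_bin expr_div_n -/A le_eqVlt; apply/orP; left; apply/eqP; field.
by rewrite pnatr_eq0 -lt0n fact_gt0 expf_neq0.
Qed.

Variables (m : nat -> R).
Hypothesis m_pos : moment_positive m.
Let u n := m n / n`!%:R.
Hypothesis u_entire : entire_coef u.

(** Positivity is applied to the square of the truncation of al Re w + be Im w to
    degree less than [N].  Its coefficients are the exact ones below degree [N], and
    those of degree between [N] and 2 [N] contribute at most a slice of the tail of a
    convergent series. *)
Lemma trig_square_ge0 :
  0 <= (al ^+ 2 - be ^+ 2) * cos_series u th rho + 2 * al * be * sin_series u th rho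
     + (al ^+ 2 + be ^+ 2) * cos_series u 0 (rho * cos th).
Proof.
pose S : nat -> R := pseries (fun n => `|u n|) `|rho|.
have cS : cvgn S.
  by apply: cvg_pseries_entire => B B0; have [M hM] := u_entire B0; exists M => n;
    rewrite normr_id.
pose A := (`|al| + `|be|) ^+ 2.
pose V N := ((al ^+ 2 - be ^+ 2) * pseries (fun n => u n * cos (n%:R * th)) rho N
  + 2 * al * be * pseries (fun n => u n * sin (n%:R * th)) rho N
  + (al ^+ 2 + be ^+ 2) * pseries (fun n => u n * cos (n%:R * 0)) (rho * cos th) N) / 2.
have cV : V @ \oo --> ((al ^+ 2 - be ^+ 2) * cos_series u th rho + 2 * al * be
  * sin_series u th rho
     + (al ^+ 2 + be ^+ 2) * cos_series u 0 (rho * cos th)) / 2.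
  apply: cvgMr_tmp; apply: cvgD; first apply: cvgD; apply: cvgMl_tmp.
  - exact: cvg_pseries_entire (entire_coefM u_entire (fun n => cos_max _)).
  - exact: cvg_pseries_entire (entire_coefM u_entire (fun n => sin_max _)).
  - exact: cvg_pseries_entire (entire_coefM u_entire (fun n => cos_max _)).
have VE N : V N = \sum_(n < N) (\sum_(j < n.+1) x j * x (n - j)%N) * m n.
  rewrite /V /pseries /series /= !big_mkord !mulr_sumr -!big_split /= mulr_suml.
  apply: eq_bigr => n _; rewrite trig_square_coef /u mulr0 cos0 exprMn; ring.
have Vge N : - (A * (S (N + N)%N - S N)) <= V N.
  pose p := \poly_(j < N) x j.
  have := m_pos N x; rewrite moment_form_poly -/p (big_cat_nat (n := N)) ?leq_addr//=.
  have -> : \sum_(0 <= i < N) (p * p)`_i * m i = V N.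
    rewrite big_mkord VE; apply: eq_bigr => n _; congr (_ * _).
    rewrite coefM; apply: eq_bigr => j _; rewrite !coef_poly.
    rewrite (leq_ltn_trans _ (ltn_ord n)); last by rewrite -ltnS.
    by rewrite (leq_ltn_trans _ (ltn_ord n))// leq_subr.
  rewrite -lerBlDl sub0r.
  move=> h; rewrite lerNl; apply: le_trans h _; apply: le_trans (ler_norm _) _;
    apply: le_trans (ler_norm_sum _ _ _) _.
  rewrite /S /pseries /series /= [X in X - _](big_cat_nat (n := N)) ?leq_addr//=
    addrAC subrr add0r.
  rewrite mulr_sumr; apply: ler_sum => i _.
  rewrite normrM (le_trans (ler_wpM2r (normr_ge0 _) (trig_square_coef_le _ _)))//.
  rewrite /A /u normrM normfV normr_nat le_eqVlt; apply/orP; left; apply/eqP; ring.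
have cL : (fun N => - (A * (S (N + N)%N - S N))) @ \oo --> 0.
  have cSS : (fun N => S (N + N)%N) @ \oo --> limn S.
    apply: (@cvg_comp _ _ _ (fun N => (N + N)%N) S _ \oo) => //.
    by apply/cvgnyPge => K; exists K => // n /= Kn; rewrite (leq_trans Kn)// leq_addr.
  have -> : 0 = - (A * (limn S - limn S)) by rewrite subrr mulr0 oppr0.
  by apply: cvgN; apply: cvgMl_tmp; apply: cvgB.
rewrite -(pmulr_lge0 _ (_ : 0 < 2^-1)) ?invr_gt0//.
rewrite -(cvg_lim _ cV)// -(cvg_lim _ cL)//.
apply: ler_lim; [exact: cvgP cL|exact: cvgP cV|exact: nearW].
Qed.

End TrigSquares.

(** * Marcinkiewicz's theorem for positive moment sequences *)

(** [m] and [k] are the moments and the cumulants of the same law: with f and P the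
    exponential generating functions of [m] and [k], this is f' = P' f and f(0) = 1. *)
Definition moment_recursion (R : pzRingType) (k m : nat -> R) := m 0%N = 1 /\
  forall n, m n.+1 = \sum_(j < n.+1) 'C(n, j)%:R * k j.+1 * m (n - j)%N.

Section Marcinkiewicz.
Variables (R : realType) (k m : nat -> R).
Hypothesis mk : moment_recursion k m.
Hypothesis m_pos : moment_positive m.

Let a j := k j.+1 / j`!%:R.
Let u n := m n / n`!%:R.

Let fact0 n : n`!%:R != 0 :> R. Proof. by rewrite pnatr_eq0 -lt0n fact_gt0. Qed.

Lemma fact_recursion n : n.+1%:R * u n.+1 = \sum_(j < n.+1) a j * u (n - j)%N.
Proof.
rewrite /u mk.2 mulr_suml mulr_sumr; apply: eq_bigr => j _.
have jn : (j <= n)%N by rewrite -ltnS.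
rewrite factS natrM /a -(bin_fact jn) !natrM.
by field; rewrite !fact0 !pnatr_eq0 -!lt0n bin_gt0 jn addrC natr1 pnatr_eq0.
Qed.

Variable e : nat.
Hypothesis k_tail : forall r, (e < r)%N -> k r = 0.

Let a_tail j : (e <= j)%N -> a j = 0.
Proof. by move=> ej; rewrite /a k_tail// mul0r. Qed.

Let u0 : u 0%N = 1. Proof. by rewrite /u mk.1 divr1. Qed.

Let u_entire : entire_coef u.
Proof. exact: (entire_conv_recursion a_tail fact_recursion). Qed.

(** The ridge inequality |f(z)| <= f(Re z) at z = rho e^(i th), in logarithmic form.
    By [trig_square_ge0] the quadratic form with matrix
    (f(Re z) + Re f(z), Im f(z); Im f(z), f(Re z) - Re f(z)) is positive semidefinite, and
    its determinant is f(Re z)^2 - |f(z)|^2. *)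
Lemma log_modulus_ridge th rho :
  (log_modulus a e th).[rho] <= (log_modulus a e 0).[rho * cos th].
Proof.
have Q al be := @trig_square_ge0 _ al be th rho _ m_pos u_entire.
have := modulus_series a_tail u0 fact_recursion 0 (rho * cos th).
have -> : sin_series u 0 (rho * cos th) = 0.
  rewrite /sin_series; apply: cvg_lim => //.
  rewrite [X in X @ _](_ : _ = cst 0); first exact: cvg_cst.
  by apply/funext => N; rewrite /pseries /series /= big1// => i _;
    rewrite mulr0 sin0 mulr0 mul0r.
have := modulus_series a_tail u0 fact_recursion th rho.
move: (Q) => {Q}; rewrite -/u.
set f := cos_series u 0 _; set F1 := cos_series _ _ _; set F2 := sin_series _ _ _.
move=> Q hF hf.
have f2 : 0 < f ^+ 2 by rewrite -[f ^+ 2]addr0 -[0 in X in _ < X](expr0n _ 2) hf expR_gt0.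
have P1 : 0 <= f + F1 by have := Q 1 0; lra.
have P2 : 0 <= f - F1 by have := Q 0 1; lra.
(* Evaluating the form at a column of the adjugate of its matrix gives the determinant
   times a diagonal entry; one of the diagonal entries is nonzero because f is. *)
have D : F1 ^+ 2 + F2 ^+ 2 <= f ^+ 2.
  have [h|h] := ltP 0 (f + F1).
    have := Q (- F2) (f + F1).
    have -> : ((- F2) ^+ 2 - (f + F1) ^+ 2) * F1 + 2 * - F2 * (f + F1) * F2 +
     ((- F2) ^+ 2 + (f + F1) ^+ 2) * f = (f + F1) * (f ^+ 2 - F1 ^+ 2 - F2 ^+ 2) by ring.
    by rewrite pmulr_rge0//; lra.
  have h' : 0 < f - F1.
    rewrite lt_neqAle P2 andbT eq_sym; apply/eqP => h0.
    have f0 : f = 0 by lra.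
    by move: f2; rewrite f0 expr0n ltxx.
  have := Q (f - F1) (- F2).
  have -> : ((f - F1) ^+ 2 - (- F2) ^+ 2) * F1 + 2 * (f - F1) * - F2 * F2 +
     ((f - F1) ^+ 2 + (- F2) ^+ 2) * f = (f - F1) * (f ^+ 2 - F1 ^+ 2 - F2 ^+ 2) by ring.
  by rewrite pmulr_rge0//; lra.
move: D; rewrite hF; move: hf; rewrite expr0n addr0 => ->.
by rewrite ler_expR ler_pM2l.
Qed.

(** The leading term of the ridge inequality as rho tends to infinity. *)
Lemma top_cumulant_angle th : (0 < e)%N -> k e * (cos (e%:R * th) - cos th ^+ e) <= 0.
Proof.
move=> e0.
pose c i := if i is j.+1 then a j / j.+1%:R else 0.
pose D := \poly_(i < e.+1) (c i * (cos (i%:R * th) - cos th ^+ i)).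
have De : D`_e = k e / e`!%:R * (cos (e%:R * th) - cos th ^+ e).
  rewrite coef_poly ltnSn; congr (_ * _); case: e e0 => // j _.
  by rewrite /c /a factS natrM invfM mulrA mulrAC.
have D0 x : D.[x] <= 0.
  have := log_modulus_ridge th x; rewrite -subr_le0; congr (_ <= _).
  rewrite /log_modulus /D !horner_poly -sumrB; apply: eq_bigr => -[[|i] ilt] _ /=.
    by rewrite !mul0r subr0.
  by rewrite mulr0 cos0 mulr1 exprMn; ring.
suff : D`_e <= 0.
  by rewrite De mulrAC pmulr_lle0 ?invr_gt0 ?ltr0n ?fact_gt0.
(* [D] with its coefficients reversed: its values at 1/n have the sign of [D.[n]], and
   its value at 0 is the top coefficient of [D]. *)
pose E := \poly_(i < e.+1) D`_(e - i).
have E0 : E.[0] = D`_e by rewrite horner_coef0 coef_poly subn0.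
have En n : E.[(n.+1%:R)^-1] <= 0.
  have n0 : n.+1%:R != 0 :> R by rewrite pnatr_eq0.
  have -> : E.[(n.+1%:R)^-1] = n.+1%:R ^- e * D.[n.+1%:R].
    rewrite /E horner_poly (reindex_inj rev_ord_inj) /=.
    rewrite (@horner_coef_wide _ e.+1) ?size_poly// mulr_sumr; apply: eq_bigr => i _.
    have ie : (i <= e)%N by rewrite -ltnS.
    rewrite subSS subKn// mulrCA; congr (_ * _).
    have -> : n.+1%:R ^- e = n.+1%:R ^- (e - i) * n.+1%:R ^- i :> R.
      by rewrite -invfM -exprD subnK.
    by rewrite exprVn -mulrA mulVf ?mulr1// expf_neq0.
  by rewrite pmulr_rle0// invr_gt0 exprn_gt0.
rewrite -E0.
have cE : horner E \o harmonic @ \oo --> E.[0].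
  by apply: continuous_cvg; [exact: continuous_horner|exact: cvg_harmonic].
rewrite -(cvg_lim _ cE)//; apply: limr_le; first exact: cvgP cE.
by apply: nearW => n; exact: En.
Qed.

(** At the angles 2 pi / e and pi / e, cos (e th) takes the values 1 and -1, while
    |cos th| < 1 because e >= 3: the two inequalities have opposite signs. *)
Lemma top_cumulant_eq0 : (3 <= e)%N -> k e = 0.
Proof.
move=> e3; have e0 : (0 < e)%N by rewrite (leq_trans _ e3).
have e0R : 0 < e%:R :> R by rewrite ltr0n.
have small (x : R) : 0 < x < pi -> `|cos x ^+ e| < 1.
  move=> /sin_gt0_pi s0; rewrite normrX exprn_ilt1 -?lt0n//.
  rewrite -(ltr_pXn2r (n := 2)) ?nnegrE// expr1n real_normK ?num_real//.
  by rewrite cos2sin2 ltrBlDr ltrDl exprn_gt0.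
have p2 : 0 < 2 * (pi : R) / e%:R < pi.
  apply/andP; split; first by rewrite divr_gt0// mulr_gt0 ?pi_gt0.
  by rewrite ltr_pdivrMr// mulrC ltr_pM2l ?pi_gt0// ltr_nat.
have p1 : 0 < (pi : R) / e%:R < pi.
  apply/andP; split; first by rewrite divr_gt0 ?pi_gt0.
  by rewrite ltr_pdivrMr// -[ltLHS]mulr1 ltr_pM2l ?pi_gt0// ltr1n (leq_trans _ e3).
have cos2piE : cos (2 * pi) = 1 :> R by rewrite mulr_natl cos2pi.
have := top_cumulant_angle (2 * pi / e%:R) e0.
have := top_cumulant_angle (pi / e%:R) e0.
rewrite ![e%:R * _]mulrC !divfK ?gt_eqF// cospi cos2piE.
move: (small _ p1) (small _ p2); rewrite !ltr_norml => /andP[h1 _] /andP[_ h2] h3 h4.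
apply/eqP; rewrite eq_le; apply/andP; split.
  by move: h4; rewrite pmulr_lle0 ?subr_gt0.
by move: h3; rewrite nmulr_lle0 ?subr_lt0.
Qed.

End Marcinkiewicz.

(** Marcinkiewicz's theorem: a law whose cumulants vanish from some order on is normal
    or degenerate.  The top order is lowered one step at a time. *)
Theorem marcinkiewicz (R : realType) (k m : nat -> R) s :
    moment_recursion k m -> moment_positive m ->
    (forall r, (s <= r)%N -> k r = 0) ->
  forall r, (3 <= r)%N -> k r = 0.
Proof.
move=> mk m_pos; elim: s => [|s IH] ks; first by move=> r _; exact: ks.
have [s3|s3] := ltnP s 3.
  by move=> r r3; apply: ks; rewrite (leq_trans _ r3).
apply: IH => r; rewrite leq_eqVlt => /predU1P[<-|]; last exact: ks.
exact: (top_cumulant_eq0 mk m_pos).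
Qed.

(** * Janson's theorem on vanishing cumulants *)

Section UltrafilterLimits.
Variables (R : realType) (T : Type) (U : set_system T).
Hypothesis U_ultra : UltraFilter U.

Lemma ultra_fmap (S : Type) (f : T -> S) : UltraFilter (f x @[x --> U]).
Proof.
split; first exact: fmap_proper_filter.
move=> G GF UG; rewrite eqEsubset; split => // A GA.
have [//|UA] := in_ultra_setVsetC (f @^-1` A) U_ultra.
have : G (~` A) by apply: UG.
by move=> /(filterI GA); rewrite setICr => /filter_not_empty.
Qed.

(** Ultrafilters stand in for the extraction of convergent subsequences. *)
Lemma ultra_bounded_cvg (f : T -> R) M :
  (\forall x \near U, `|f x| <= M) -> cvg (f x @[x --> U]).
Proof.
move=> fM; have UF := ultra_fmap f.
have := @segment_compact R (- M) M; rewrite compact_ultra => /(_ _ UF).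
case; last by move=> l [_ fl]; apply/cvg_ex; exists l.
by near=> x => /=; rewrite in_itv /= -ler_norml; near: x.
Unshelve. all: by end_near. Qed.

End UltrafilterLimits.

Section Moments.
Variables (R : realType) (T : Type) (F : set_system T) (FF : ProperFilter F).
Variables (k m : T -> nat -> R).
Hypothesis mk : \forall x \near F, moment_recursion (k x) (m x).

Lemma cvg_moment_step (K M : nat -> R) r :
    (forall j, k x j.+1 @[x --> F] --> K j.+1) ->
    (forall j, (j <= r)%N -> m x j @[x --> F] --> M j) ->
  m x r.+1 @[x --> F] --> \sum_(j < r.+1) 'C(r, j)%:R * K j.+1 * M (r - j)%N.
Proof.
move=> kK mM.
have cS : \sum_(j < r.+1) 'C(r, j)%:R * k x j.+1 * m x (r - j)%N @[x --> F] -->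
    \sum_(j < r.+1) 'C(r, j)%:R * K j.+1 * M (r - j)%N.
  apply: cvg_sumr => j _; apply: cvgM; last exact: mM (leq_subr _ _).
  by apply: cvgMl_tmp; exact: kK.
apply: cvg_trans cS; apply: near_eq_cvg; near=> x.
by have [_ ->] : moment_recursion (k x) (m x) by near: x.
Unshelve. all: by end_near. Qed.

Lemma cvg_moment0 : m x 0%N @[x --> F] --> (1 : R).
Proof.
apply: cvg_near_cst; near=> x.
by have [] : moment_recursion (k x) (m x) by near: x.
Unshelve. all: by end_near. Qed.

Lemma cvg_moments (K M : nat -> R) : moment_recursion K M ->
    (forall r, (0 < r)%N -> k x r @[x --> F] --> K r) ->
  forall r, m x r @[x --> F] --> M r.
Proof.
move=> [M0 MK] kK; elim/ltn_ind => -[_|r IH].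
  by rewrite M0; exact: cvg_moment0.
by rewrite MK; apply: cvg_moment_step => j; [exact: kK|exact: IH].
Qed.

(** The recursion expresses each moment through the cumulants, so limits of the
    cumulants force limits of the moments, related by the same recursion. *)
Lemma is_cvg_moments :
    (forall r, (0 < r)%N -> cvg (k x r @[x --> F])) ->
  exists2 M, moment_recursion (fun r => lim (k x r @[x --> F])) M &
    forall r, m x r @[x --> F] --> M r.
Proof.
move=> ck; have cm r : cvg (m x r @[x --> F]).
  elim/ltn_ind: r => -[_|r IH]; first exact: cvgP cvg_moment0.
  apply: cvgP; apply: (@cvg_moment_step (fun i => lim (k x i @[x --> F]))
    (fun i => lim (m x i @[x --> F])) r) => j; [exact: ck|exact: IH].
exists (fun r => lim (m x r @[x --> F])) => //; split.
  by apply: cvg_lim => //; exact: cvg_moment0.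
by move=> r; apply: cvg_lim => //; apply:
  (@cvg_moment_step (fun i => lim (k x i @[x --> F]))
    (fun i => lim (m x i @[x --> F])) r) => j; [exact: ck|move=> _; exact: cm].
Qed.

Lemma moment_positive_lim (M : nat -> R) :
    (\forall x \near F, moment_positive (m x)) ->
    (forall r, m x r @[x --> F] --> M r) ->
  moment_positive M.
Proof.
move=> m_pos mM N c.
have cS : \sum_(i < N) \sum_(j < N) c i * c j * m x (i + j)%N @[x --> F] -->
    \sum_(i < N) \sum_(j < N) c i * c j * M (i + j)%N.
  apply: cvg_sumr => i _; apply: cvg_sumr => j _.
  by apply: cvgMl_tmp; exact: mM.
rewrite -(cvg_lim _ cS)//; apply: limr_ge; first exact: cvgP cS.
by apply: filterS m_pos => x; exact.
Qed.

End Moments.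

Section Rescaling.
Variables (R : realType) (k m : nat -> R) (la : R).

Lemma moment_recursion_scale : la != 0 -> moment_recursion k m ->
  moment_recursion (fun r => k r / la ^+ r) (fun r => m r / la ^+ r).
Proof.
move=> la0 [m0 mk]; split=> [|n]; first by rewrite expr0 divr1.
rewrite mk mulr_suml; apply: eq_bigr => j _.
have -> : la ^+ n.+1 = la ^+ j.+1 * la ^+ (n - j).
  by rewrite -exprD addSn subnKC// -ltnS.
by field; rewrite !expf_neq0.
Qed.

Lemma moment_positive_scale : moment_positive m ->
  moment_positive (fun r => m r / la ^+ r).
Proof.
move=> m_pos N c; have := m_pos N (fun i => c i / la ^+ i); congr (_ <= _).
apply: eq_bigr => i _; apply: eq_bigr => j _.
by rewrite exprD invfM; ring.
Qed.

End Rescaling.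

(** Suppose some k_r stays away from 0 along an ultrafilter finer than the filter of
    cofinite sets.  Divide the variables by la_n = max(1, |k_i|^(1/i); 3 <= i < s).  The
    rescaled cumulants are bounded, so they converge along the ultrafilter, with limit 0
    for the orders i >= s; by Marcinkiewicz's theorem the limits vanish for all i >= 3.
    But if la_n > 1, one of the rescaled cumulants of order 3 <= i < s has absolute
    value 1.  Hence la_n = 1 for most n, the rescaling does nothing, and k_r tends to 0
    along the ultrafilter after all. *)
Theorem janson_cumulants (R : realType) (k m : nat -> nat -> R) s :
    (\forall n \near \oo, moment_recursion (k n) (m n)) ->
    (\forall n \near \oo, moment_positive (m n)) ->
    (\forall n \near \oo, k n 1%N = 0) ->
    (\forall n \near \oo, k n 2%N = 1) ->
    (forall r, (s <= r)%N -> k n r @[n --> \oo] --> 0) ->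
  forall r, (3 <= r)%N -> k n r @[n --> \oo] --> 0.
Proof.
move=> mk m_pos k1 k2 ks r r3.
apply/cvgrPdist_lt => eps eps0; apply: contrapT => nk.
pose A := [set n | eps <= `|k n r|].
(* [A] meets every cofinite set, for otherwise [nk] would fail. *)
have WF : ProperFilter (within A \oo).
  split; last exact: within_filter.
  rewrite /within /= => h; apply: nk; near=> n.
  have An : A n -> False by near: n.
  by rewrite sub0r normrN ltNge; apply/negP.
have [U [U_ultra WU]] := ultraFilterLemma WF.
have UA : U A by apply: WU; rewrite /within /=; exact: nearW.
have oU : \oo `<=` U by move=> B oB; apply: WU; rewrite /within /=; move: oB;
  exact: filterS.
pose w n i := `|k n i| `^ i%:R^-1.
pose la n := \big[Num.max/1]_(i < s | (3 <= i)%N) w n i.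
have la1 n : 1 <= la n by rewrite /la; elim/big_rec: _ => // i x _ x1;
  rewrite le_max x1 orbT.
have la0 n : 0 < la n by rewrite (lt_le_trans _ (la1 n)).
have wX n i : (0 < i)%N -> w n i ^+ i = `|k n i|.
  move=> i0; rewrite /w -powR_mulrn ?powR_ge0// -powRrM mulVf ?powRr1//.
  by rewrite pnatr_eq0 -lt0n.
have lak n i : (3 <= i < s)%N -> `|k n i / la n ^+ i| <= 1.
  move=> /andP[i3 si]; have i0 : (0 < i)%N by rewrite (leq_trans _ i3).
  rewrite normrM normfV normrX (gtr0_norm (la0 n)) ler_pdivrMr ?exprn_gt0// mul1r -wX//.
  rewrite ler_pXn2r ?nnegrE ?powR_ge0 ?(ltW (la0 n))//.
  rewrite /la; apply: (@le_bigmax_cond _ _ _ 1 (Ordinal si) (fun i : 'I_s => (3 <= i)%N)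
    (fun i : 'I_s => w n i)); exact: i3.
have la_att n : la n = 1 \/ exists2 i, (3 <= i < s)%N & `|k n i / la n ^+ i| = 1.
  have : la n = 1 \/ exists2 i, (3 <= i < s)%N & la n = w n i.
    rewrite /la; elim/big_rec: _ => [|i x i3 IH]; first by left.
    rewrite maxEle; case: ifP => _ //; right; exists (nat_of_ord i) => //.
    by rewrite i3 ltn_ord.
  case=> [|[i i3 lai]]; [by left|right; exists i => //].
  have i0 : (0 < i)%N by rewrite (leq_trans _ (proj1 (andP i3))).
  rewrite normrM normfV normrX (gtr0_norm (la0 n)) lai wX// divff//.
  by rewrite -wX// -lai expf_neq0// gt_eqF.
pose k' n i := k n i / la n ^+ i.
pose m' n i := m n i / la n ^+ i.
have k's i : (s <= i)%N -> k' n i @[n --> U] --> 0.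
  move=> si; apply/norm_cvg0P.
  have k0 : `|k n i| @[n --> U] --> 0.
    by apply/norm_cvg0P; apply: cvg_trans (ks i si); apply: cvg_app.
  apply: (squeeze_cvgr _ (cvg_cst 0) k0); near=> n.
  rewrite normr_ge0 /= /k' normrM normfV normrX (gtr0_norm (la0 n)).
  by rewrite ler_pdivrMr ?exprn_gt0// ler_peMr// exprn_ege1.
have k'c i : (0 < i)%N -> cvg (k' n i @[n --> U]).
  move=> i0; have [si|si] := leqP s i; first exact: cvgP (k's i si).
  apply: (@ultra_bounded_cvg _ _ _ _ _ 1).
  have [i3|i3] := leqP 3 i.
    by apply: nearW => n; apply: lak; rewrite i3.
  have H1 : \forall n \near U, k n 1%N = 0 by exact: oU.
  have H2 : \forall n \near U, k n 2%N = 1 by exact: oU.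
  near=> n; have e1 : k n 1%N = 0 by near: n.
  have e2 : k n 2%N = 1 by near: n.
  rewrite /k'; case: i i0 i3 {si} => [|[|[|]]]// _ _.
    by rewrite e1 mul0r normr0.
  rewrite e2 div1r normfV normrX (gtr0_norm (la0 n)) invf_le1 ?exprn_gt0//.
  by rewrite exprn_ege1.
have m'k' : \forall n \near U, moment_recursion (k' n) (m' n).
  apply: oU; move: mk; apply: filterS => n.
  by apply: moment_recursion_scale; rewrite gt_eqF.
have [M MK mM] := is_cvg_moments _ m'k' k'c.
have M_pos : moment_positive M.
  apply: moment_positive_lim mM.
  by apply: oU; move: m_pos; apply: filterS => n; exact: moment_positive_scale.
have K0 i : (3 <= i)%N -> k' n i @[n --> U] --> 0.
  move=> i3; have <- : lim (k' n i @[n --> U]) = 0.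
    apply: (@marcinkiewicz _ _ _ s MK M_pos _ _ i3) => j sj.
    by apply: cvg_lim => //; exact: k's.
  by apply: k'c; rewrite (leq_trans _ i3).
have lt1 i : (3 <= i)%N -> \forall n \near U, `|k' n i| < 1.
  by move=> /K0 /cvgr_norm_lt; apply; rewrite normr0.
have all_lt1 : \forall n \near U, forall i : 'I_s, (3 <= i)%N -> `|k' n i| < 1.
  apply: filter_forall => i.
  by have [i3|i3] := leqP 3 i; [move: (lt1 i i3); exact: filterS|exact: nearW].
have : \forall n \near U, `|k' n r| < eps.
  by apply: cvgr_norm_lt (K0 r r3) _ _; rewrite normr0.
move=> Ueps.
have : \forall n \near U, False.
  near=> n.
  have An : A n by near: n.
  have l1 : forall i : 'I_s, (3 <= i)%N -> `|k' n i| < 1 by near: n.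
  have e1 : `|k' n r| < eps by near: n.
  have la_1 : la n = 1.
    case: (la_att n) => // -[i /andP[i3 si] ki].
    by have := l1 (Ordinal si) i3; rewrite /= /k' ki ltxx.
  by move: e1; rewrite /k' la_1 expr1n divr1 ltNge An.
by move=> /filter_ex[].
Unshelve. all: by end_near. Qed.

(** * Set partitions and the moment-cumulant recursion *)

(** The joint cumulant of the variables indexed by [S], when [mu C] is the expectation
    of the product of those indexed by [C]. *)
Definition partition_cumulant (R : comPzRingType) (I : finType)
    (mu : {set I} -> R) (S : {set I}) : R :=
  \sum_(pi : {set {set I}} | finset.partition pi S)
    (-1) ^+ #|pi|.-1 * (#|pi|.-1)`!%:R * \prod_(C in pi) mu C.

Section PartitionCumulant.
Import boot.finset.
Local Open Scope set_scope.
Variables (R : comPzRingType) (I : finType) (mu : {set I} -> R).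
Hypothesis mu0 : mu set0 = 1.

(** Adjoining the block [B] identifies the partitions of [V :\: B] with the partitions
    of [V] that have [B] as a block. *)
Lemma sum_partition_block (F : {set {set I}} -> R) (V B : {set I}) :
    B \subset V -> B != set0 ->
  \sum_(pi | partition pi (V :\: B)) F pi =
  \sum_(rho | partition rho V && (B \in rho)) F (rho :\ B).
Proof.
move=> BV B0; have VDB : B :|: (V :\: B) = V.
  by rewrite setDE setUIr setUCr setIT; apply/setUidPr.
have notB (pi : {set {set I}}) : partition pi (V :\: B) -> B \notin pi.
  move=> /partitionS piS; apply/negP => /piS.
  by rewrite subsetD => /andP[_]; rewrite -setI_eq0 setIid (negbTE B0).
rewrite [RHS](reindex_onto (fun pi => B |: pi) (fun rho => rho :\ B)) /=; last first.
  by move=> rho /andP[_]; exact: setD1K.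
apply: eq_big => [pi|pi piP]; last by rewrite setU1K// notB.
apply/idP/idP => [piP|/andP[/andP[rhoP _] /eqP piE]].
  rewrite setU11 setU1K ?notB// eqxx !andbT -VDB partitionU1//.
  by rewrite -setI_eq0 setDE setICA setICr setI0.
by have := partitionD1 rhoP (setU11 B pi); rewrite piE.
Qed.

(** Expand the cumulants and collect the terms that give the same partition of [V],
    with b blocks.  The set S = [V] contributes (-1)^(b-1) (b-1)!, and each of the b - 1
    blocks that avoid [x], in the role of the complement of S, contributes
    (-1)^(b-2) (b-2)!.  The total is 0 unless b = 1. *)
Lemma cumulant_inversion (V : {set I}) x : x \in V ->
  \sum_(S : {set I} | (S \subset V) && (x \in S))
    partition_cumulant mu S * mu (V :\: S) = mu V.
Proof.
move=> xV; rewrite (bigD1 V) ?subxx//= setDv mu0 mulr1.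
have -> : \sum_(S : {set I} | (S \subset V) && (x \in S) && (S != V))
    partition_cumulant mu S * mu (V :\: S) =
  \sum_(B : {set I} | [&& B \subset V, x \notin B & B != set0])
    partition_cumulant mu (V :\: B) * mu B.
  rewrite (reindex_onto (fun B => V :\: B) (fun S => V :\: S)) /=; last first.
    by move=> S /andP[/andP[SV _] _]; rewrite setDDr setDv set0U; apply/setIidPr.
  apply: eq_big => [B|B /andP[_ /eqP ->]//].
  have [BV|BV] /= := boolP (B \subset V); last first.
    apply/negbTE; apply: contra BV => /andP[_ /eqP <-]; exact: subsetDl.
  rewrite subsetDl inE xV andbT setDDr setDv set0U (setIidPr BV) eqxx andbT.
  congr (_ && ~~ _); apply/eqP/eqP => [h|->]; last by rewrite setD0.
  by rewrite -(setIidPr BV) -{1}h setIC setDE setICA setICr setI0.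
rewrite {1}/partition_cumulant.
have -> : \sum_(B : {set I} | [&& B \subset V, x \notin B & B != set0])
    partition_cumulant mu (V :\: B) * mu B =
  \sum_(rho : {set {set I}} | partition rho V)
     \sum_(B in rho | x \notin B) (-1) ^+ #|rho|.-2 * (#|rho|.-2)`!%:R *
         \prod_(C in rho) mu C.
  rewrite (exchange_big_dep (fun B : {set I} => [&& B \subset V, x \notin B & B != set0]))
    /=.
    apply: eq_bigr => B /and3P[BV xB B0].
    rewrite /partition_cumulant sum_partition_block// mulr_suml.
    apply: eq_big => [rho|rho /andP[rhoP Brho]]; first by rewrite xB andbT.
    have -> : #|rho :\ B| = #|rho|.-1 by rewrite (cardsD1 B rho) Brho.
    rewrite -[LHS]mulrA; congr (_ * _); rewrite mulrC [RHS](bigD1 B)//=; congr (_ * _).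
    by apply: eq_bigl => C; rewrite !inE andbC.
  move=> rho B rhoP /andP[Brho ->]; rewrite (partitionS rhoP Brho) /=.
  exact: partition_neq0 rhoP Brho.
(* The partition with the single block [V] contributes [mu V]; all others cancel. *)
rewrite -big_split /= (bigD1 [set V]) /=; last first.
  by rewrite /partition /cover big_set1 eqxx inE eq_sym -card_gt0 (cardD1 x) xV trivIset1.
rewrite cards1 /= big_set1 big1 ?addr0; last first.
  by move=> B /andP[]; rewrite inE => /eqP ->; rewrite xV.
rewrite big1 ?addr0 ?expr0 ?mulr1 ?mul1r// => rho /andP[rhoP rhoV].
rewrite sumr_const.
have xcov : x \in cover rho by rewrite (cover_partition rhoP).
have pb := pblock_mem xcov.
have -> : #|[pred B in rho | x \notin B]| = #|rho|.-1.
  rewrite (cardsD1 (pblock rho x) rho) pb add1n /=; apply: eq_card => B.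
  rewrite !inE andbC; apply: andb_id2r => Brho.
  congr negb; apply/idP/eqP => [xB|->]; last by rewrite mem_pblock.
  by rewrite (def_pblock (partition_trivIset rhoP) Brho xB).
have rho2 : (1 < #|rho|)%N.
  rewrite (cardsD1 (pblock rho x) rho) pb add1n ltnS card_gt0.
  apply: contra rhoV => /eqP rho0; have rhoE : rho = [set pblock rho x].
    by rewrite -[LHS](setD1K pb) rho0 setU0.
  have := cover_partition rhoP; rewrite {1}rhoE /cover big_set1 => pV.
  by rewrite rhoE pV.
case: #|rho| rho2 => [|[|n]]//= _.
by rewrite exprS factS natrM -mulr_natl; ring.
Qed.

Lemma sum_subsets_card (G : nat -> R) (V : {set I}) x n : x \in V -> #|V| = n.+1 ->
  \sum_(S : {set I} | (S \subset V) && (x \in S)) G #|S| =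
  \sum_(j < n.+1) 'C(n, j)%:R * G j.+1.
Proof.
move=> xV Vn; have Vx : #|V :\ x| = n by move: (cardsD1 x V); rewrite xV Vn add1n => -[].
rewrite (reindex_onto (fun B => x |: B) (fun S => S :\ x)) /=; last first.
  by move=> S /andP[_]; exact: setD1K.
rewrite (eq_bigl (fun B : {set I} => B \subset V :\ x)); last first.
  move=> B; rewrite setU11 andbT subUset sub1set xV /= subsetD1.
  congr (_ && _); apply/eqP/idP => [<-|]; [by rewrite !inE eqxx|exact: setU1K].
have cardB (B : {set I}) : B \subset V :\ x -> (#|B| < n.+1)%N.
  by move=> /subset_leq_card; rewrite Vx.
rewrite (partition_big (fun B : {set I} => inord #|B| : 'I_n.+1) predT)//=.
apply: eq_bigr => j _.
transitivity (\sum_(B in [set B : {set I} | (B \subset V :\ x) && (#|B| == j)]) G j.+1).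
  apply: eq_big => B.
    rewrite inE; have [BV|//] /= := boolP (B \subset V :\ x).
    by rewrite -val_eqE /= inordK ?cardB.
  case/andP => BV; rewrite -val_eqE /= inordK ?cardB// => /eqP <-.
  rewrite cardsU1; suff -> : x \notin B by [].
  by move: BV; rewrite subsetD1 => /andP[].
by rewrite sumr_const cards_draws Vx mulr_natl.
Qed.

End PartitionCumulant.

Section CumulantOfCard.
Import boot.finset.
Variables (R : comPzRingType) (m : nat -> R).
Hypothesis m0 : m 0%N = 1.

Definition card_cumulant n : R :=
  partition_cumulant (fun C : {set 'I_n} => m #|C|) [set: 'I_n]%SET.

(** The inversion formula determines the cumulant of [V] from those of smaller sets.
    Strong induction on the cardinal therefore shows at once that the cumulant depends
    on the cardinal alone and that the recursion holds. *)
Lemma cumulant_card_ind n :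
  forall (I : finType) (V : {set I}), #|V| = n.+1 ->
  partition_cumulant (fun C : {set I} => m #|C|) V = card_cumulant n.+1 /\
  m n.+1 = \sum_(j < n.+1) 'C(n, j)%:R * card_cumulant j.+1 * m (n - j)%N.
Proof.
elim/ltn_ind: n => n IH.
have rec (J : finType) (V : {set J}) : #|V| = n.+1 ->
    partition_cumulant (fun C : {set J} => m #|C|) V
    + \sum_(j < n) 'C(n, j)%:R * card_cumulant j.+1 * m (n - j)%N = m n.+1.
  move=> Vn; have [x xV] : exists x, x \in V by apply/set0Pn; rewrite -card_gt0 Vn.
  have := @cumulant_inversion _ _ (fun C : {set J} => m #|C|) _ V x xV.
  rewrite cards0 => /(_ m0); rewrite Vn => <-.
  pose G j := if (j == n.+1) then partition_cumulant (fun C : {set J} => m #|C|) V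
     else card_cumulant j * m (n.+1 - j)%N.
  transitivity (\sum_(S : {set J} | (S \subset V) && (x \in S)) G #|S|).
    rewrite (sum_subsets_card _ xV Vn) big_ord_recr /= binn mul1r addrC.
    congr (_ + _); first by rewrite /G eqxx.
    apply: eq_bigr => j _; rewrite /G eqSS ltn_eqF// subSS mulrA //.
  apply: eq_bigr => S /andP[SV xS]; rewrite /G.
  case: eqP => [Sn|/eqP Sn].
    have -> : S = V by apply/eqP; rewrite eqEcard SV Sn Vn /=.
    by rewrite finset.setDv cards0 m0 mulr1.
  have SVlt : (#|S| < n.+1)%N by rewrite ltn_neqAle Sn -Vn subset_leq_card.
  have S0 : (0 < #|S|)%N by rewrite card_gt0; apply/set0Pn; exists x.
  rewrite cardsD (setIidPr SV) Vn; congr (_ * _).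
  have Ss : #|S| = #|S|.-1.+1 by rewrite prednK.
  by rewrite {1}Ss; case: (IH _ _ J S Ss) => [|-> _] //; rewrite -ltnS -Ss.
move=> I V Vn.
have e : partition_cumulant (fun C : {set I} => m #|C|) V = card_cumulant n.+1.
  by apply: (addIr (\sum_(j < n) 'C(n, j)%:R * card_cumulant j.+1 * m (n - j)%N));
    rewrite !rec// cardsT card_ord.
split => //.
by rewrite -(rec I V Vn) e big_ord_recr /= binn mul1r subnn m0 mulr1 addrC.
Qed.

Lemma card_cumulant_recursion : moment_recursion card_cumulant m.
Proof.
split=> // n.
by case: (@cumulant_card_ind n 'I_n.+1 [set: 'I_n.+1]%SET); rewrite ?cardsT ?card_ord.
Qed.

End CumulantOfCard.

(** * Random variables with finite moments *)

Section FiniteMoments.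
Context d (T : measurableType d) (R : realType) (P : probability T R).
Implicit Types (X Y f g : T -> R).

Lemma finite_moments_measurable X : finite_moments P X -> measurable_fun setT X.
Proof.
move=> /(_ 1%N) /measurable_int /measurable_EFinP.
by apply: eq_measurable_fun => w _; rewrite expr1.
Qed.

Lemma le_integrable_real f g : measurable_fun setT f ->
    (forall w, `|f w| <= g w) -> P.-integrable setT (EFin \o g) ->
  P.-integrable setT (EFin \o f).
Proof.
move=> mf fg; apply: le_integrable => //; first exact/measurable_EFinP.
by move=> w _ /=; rewrite lee_fin (le_trans (fg w))// ler_norm.
Qed.

(** |u v| <= u^2 + v^2 with u and v powers of [X] and [Y]; all closure properties of
    finite moments reduce to this one. *)
Lemma finite_moments_monomial X Y a b : finite_moments P X -> finite_moments P Y ->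
  P.-integrable setT (EFin \o (fun w => X w ^+ a * Y w ^+ b)).
Proof.
move=> hX hY; apply: (@le_integrable_real _ (fun w => X w ^+ a.*2 + Y w ^+ b.*2)).
- apply: measurable_funM; apply: measurable_funX; exact: finite_moments_measurable.
- move=> w; rewrite -!muln2 !exprM normrM.
  rewrite -[X in _ <= X + _]real_normK ?num_real// -[X in _ <= _ + X]real_normK ?num_real//.
  have := sqr_ge0 (`|X w ^+ a| - `|Y w ^+ b|).
  have : 0 <= `|X w ^+ a| * `|Y w ^+ b| by rewrite mulr_ge0.
  by nra.
- rewrite (_ : _ \o _ = (fun w => (X w ^+ a.*2)%:E) \+ (fun w => (Y w ^+ b.*2)%:E))%E.
    by apply: integrableD.
  by apply/funext => w.
Qed.

Lemma finite_moments_integrable X : finite_moments P X ->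
  P.-integrable setT (EFin \o X).
Proof.
by move=> /(_ 1%N); apply: eq_integrable => // w _; rewrite expr1.
Qed.

Lemma integrable_rsum (I : Type) (r : seq I) (Q : pred I) (f : I -> T -> R) :
    (forall i, Q i -> P.-integrable setT (EFin \o f i)) ->
  P.-integrable setT (EFin \o (fun w => \sum_(i <- r | Q i) f i w)).
Proof.
move=> h; rewrite (_ : _ \o _ = (fun w => \sum_(i <- r | Q i) (f i w)%:E)%E).
  by apply: integrable_sum => // i; exact: h.
by apply/funext => w /=; rewrite sumEFin.
Qed.

Lemma finite_momentsD X Y : finite_moments P X -> finite_moments P Y ->
  finite_moments P (fun w => X w + Y w).
Proof.
move=> hX hY n; rewrite [X in integrable _ _ X](_ : _ =
  EFin \o (fun w => \sum_(i < n.+1) 'C(n, i)%:R * (X w ^+ (n - i) * Y w ^+ i))).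
  apply: integrable_rsum => i _.
  rewrite (_ : _ \o _ = (fun w => ('C(n, i)%:R)%:E * (X w ^+ (n - i) * Y w ^+ i)%R%:E)%E).
    by apply: integrableZl => //; exact: finite_moments_monomial.
  by apply/funext => w /=; rewrite EFinM.
by apply/funext => w /=; rewrite exprDn; congr EFin; apply: eq_bigr => i _;
  rewrite mulr_natl.
Qed.

Lemma finite_momentsM X Y : finite_moments P X -> finite_moments P Y ->
  finite_moments P (fun w => X w * Y w).
Proof.
move=> hX hY n; have := finite_moments_monomial n n hX hY;
  apply: eq_integrable => // w _ /=.
by rewrite exprMn.
Qed.

Lemma finite_moments_cst c : finite_moments P (fun _ => c).
Proof. by move=> n; exact: finite_measure_integrable_cst. Qed.

Lemma finite_moments_sum (I : Type) (r : seq I) (Q : pred I) (X : I -> T -> R) :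
    (forall i, Q i -> finite_moments P (X i)) ->
  finite_moments P (fun w => \sum_(i <- r | Q i) X i w).
Proof.
move=> h; elim: r => [|i r IH].
  rewrite (_ : (fun w => _) = (fun=> 0)); first exact: finite_moments_cst.
  by apply/funext => w; rewrite big_nil.
rewrite (_ : (fun w => _) = (fun w => if Q i then (X i w) + (\sum_(j <- r | Q j) X j w)
    else \sum_(j <- r | Q j) X j w)); last by apply/funext => w; rewrite big_cons.
case Qi: (Q i) => //.
by apply: finite_momentsD => //; exact: h.
Qed.

Lemma finite_moments_prod (I : Type) (r : seq I) (Q : pred I) (X : I -> T -> R) :
    (forall i, Q i -> finite_moments P (X i)) ->
  finite_moments P (fun w => \prod_(i <- r | Q i) X i w).
Proof.
move=> h; elim: r => [|i r IH].
  rewrite (_ : (fun w => _) = (fun=> 1)); first exact: finite_moments_cst.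
  by apply/funext => w; rewrite big_nil.
rewrite (_ : (fun w => _) = (fun w => if Q i then (X i w) * (\prod_(j <- r | Q j) X j w)
    else \prod_(j <- r | Q j) X j w)); last by apply/funext => w; rewrite big_cons.
case Qi: (Q i) => //.
by apply: finite_momentsM => //; exact: h.
Qed.

Lemma finite_moments_powerZ X c n : finite_moments P X ->
  P.-integrable setT (EFin \o (fun w => c * X w ^+ n)).
Proof.
move=> hX; rewrite (_ : _ \o _ = (fun w => c%:E * (X w ^+ n)%:E)%E); last exact/funext.
by apply: integrableZl => //; exact: hX.
Qed.

Lemma fine_expectation X : fine 'E_P[X] = \int[P]_w X w.
Proof. by rewrite unlock. Qed.

Lemma Rintegral_sum (I : Type) (r : seq I) (Q : pred I) (f : I -> T -> R) :
    (forall i, Q i -> P.-integrable setT (EFin \o f i)) ->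
  \int[P]_w (\sum_(i <- r | Q i) f i w) = \sum_(i <- r | Q i) \int[P]_w f i w.
Proof.
move=> h; elim: r => [|i r IH].
  under eq_Rintegral do rewrite big_nil.
  by rewrite big_nil Rintegral_cst// mul0r.
rewrite big_cons; under eq_Rintegral do rewrite big_cons.
case: ifP => [Qi|_]//; rewrite RintegralD ?IH//; first exact: h.
exact: integrable_rsum.
Qed.

End FiniteMoments.

(** * Multilinearity of joint cumulants *)

Lemma sum_tuple_cons (V : nmodType) (A : finType) r (F : r.+1.-tuple A -> V) :
  \sum_(al : r.+1.-tuple A) F al = \sum_(a : A) \sum_(t : r.-tuple A) F [tuple of a :: t].
Proof.
rewrite pair_big /= (reindex (fun p : A * r.-tuple A => [tuple of p.1 :: p.2])) //=.
exists (fun t => (thead t, [tuple of behead t])) => [[a t] _|t _] /=.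
  by congr pair; exact: val_inj.
by rewrite [RHS]tuple_eta.
Qed.

(** Coordinates are expanded one at a time, starting from the first; [good] is the
    class of arguments (here, variables with finite moments) on which additivity is
    available. *)
Lemma multi_additive_expand (V : Type) (W : nmodType) (A : finType) (good : V -> Prop)
    (y : A -> V) (tot : V) r (G : ('I_r -> V) -> W) :
    (forall a, good (y a)) -> good tot ->
    (forall (x : 'I_r -> V) i, (forall j, good (x j)) -> x i = tot ->
       G x = \sum_(a : A) G (fun j => if j == i then y a else x j)) ->
  G (fun=> tot) = \sum_(al : r.-tuple A) G (fun i => y (tnth al i)).
Proof.
move=> gy gtot; elim: r G => [|r IH] G addG.
  rewrite (big_pred1 [tuple]) => [|t]; last by apply/esym/eqP; exact: tuple0.
  by congr G; apply/funext => -[].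
rewrite (addG (fun=> tot) ord0)// sum_tuple_cons; apply: eq_bigr => a _.
pose ext (x : 'I_r -> V) (i : 'I_r.+1) := if unlift ord0 i is Some j then x j else y a.
transitivity (G (ext (fun=> tot))).
  by congr G; apply/funext => i; rewrite /ext; case: unliftP => [j ->|->].
rewrite (IH (fun x => G (ext x))) => [|x i gx xi].
  apply: eq_bigr => t _; congr G; apply/funext => i; rewrite /ext.
  by case: unliftP => [j ->|->]; rewrite (tnth_nth a) /= ?(tnth_nth a).
rewrite (addG _ (lift ord0 i)).
- apply: eq_bigr => b _; congr G; apply/funext => j; rewrite /ext.
  by case: unliftP => [l ->|->]//; rewrite (inj_eq lift_inj).
- by move=> j; rewrite /ext; case: unliftP.
- by rewrite /ext liftK.
Qed.

Section CumulantMultilinear.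
Context d (T : measurableType d) (R : realType) (P : probability T R).

(** In the term of a partition, only the expectation over the block that contains [i]
    depends on the variable [X i], and it is linear in it. *)
Lemma joint_cumulant_additive r (X : 'I_r -> T -> R) (i : 'I_r) (A : finType)
    (Z : A -> T -> R) :
    (forall j, finite_moments P (X j)) -> (forall a, finite_moments P (Z a)) ->
    X i = (fun w => \sum_(a : A) Z a w) ->
  joint_cumulant P X = \sum_(a : A) joint_cumulant P (fun j => if j == i then Z a else X j).
Proof.
move=> hX hZ Xi; rewrite /joint_cumulant exchange_big /=; apply: eq_bigr => pi piP.
rewrite -mulr_sumr; congr (_ * _).
have ipi : finset.pblock pi i \in pi by rewrite finset.pblock_mem
  ?(finset.cover_partition piP)// inE.
have iB : i \in finset.pblock pi i by rewrite finset.mem_pblock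
  (finset.cover_partition piP) inE.
rewrite (bigD1 (finset.pblock pi i))//=.
under [RHS]eq_bigr => a _ do rewrite (bigD1 (finset.pblock pi i))//=.
have -> : \sum_a fine 'E_P[fun w => \prod_(j in finset.pblock pi i)
  (if j == i then Z a else X j) w] *
     (\prod_(C in pi | C != finset.pblock pi i)
       fine 'E_P[fun w => \prod_(j in C) (if j == i then Z a else X j) w]) =
   \sum_a fine 'E_P[fun w => \prod_(j in finset.pblock pi i) (if j == i then Z a else X j)
     w] *
     (\prod_(C in pi | C != finset.pblock pi i) fine 'E_P[fun w => \prod_(j in C) X j w]).
  apply: eq_bigr => a _; congr (_ * _); apply: eq_bigr => C /andP[Cpi CB].
  congr (fine 'E_P[_]); apply/funext => w; apply: eq_bigr => j jC.
  case: eqP => // ji; move: CB; rewrite -{1}(finset.def_pblock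
    (finset.partition_trivIset piP) Cpi jC).
  by move=> /eqP[]; rewrite ji.
rewrite -mulr_suml; congr (_ * _); rewrite fine_expectation.
have -> : (fun w => \prod_(j in finset.pblock pi i) X j w) = (fun w => \sum_a
    (\prod_(j in finset.pblock pi i) (if j == i then Z a else X j) w)).
  apply/funext => w; rewrite (bigD1 i)//= Xi mulr_suml; apply: eq_bigr => a _.
  rewrite [RHS](bigD1 i)//= eqxx; congr (_ * _); apply: eq_bigr => j /andP[_ ji].
  by rewrite (negbTE ji).
rewrite Rintegral_sum => [|a _]; last first.
  apply: finite_moments_integrable; apply: finite_moments_prod => j _.
  by case: ifP.
by apply: eq_bigr => a _; rewrite fine_expectation.
Qed.

Lemma joint_cumulant_sum r (A : finType) (Y : A -> T -> R) :
    (forall a, finite_moments P (Y a)) ->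
  joint_cumulant P (fun _ : 'I_r => (fun w => \sum_(a : A) Y a w)) =
  \sum_(al : r.-tuple A) joint_cumulant P (fun i => Y (tnth al i)).
Proof.
move=> hY; apply: (@multi_additive_expand _ _ _ (finite_moments P)
  Y _ r (fun X : 'I_r -> T -> R => joint_cumulant P X)) => //.
  exact: finite_moments_sum.
by move=> X i hX Xi; apply: joint_cumulant_additive.
Qed.

Definition moment (X : T -> R) n := \int[P]_w (X w ^+ n).

Definition cumulant (X : T -> R) r := joint_cumulant P (fun _ : 'I_r => X).

Lemma moment0 X : moment X 0 = 1.
Proof.
rewrite /moment; under eq_Rintegral do rewrite expr0.
by rewrite Rintegral_cst// mul1r; exact: (congr1 fine (probability_setT P)).
Qed.

Lemma cumulant_recursion X : moment_recursion (cumulant X) (moment X).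
Proof.
have := @card_cumulant_recursion _ (moment X) (moment0 X).
congr (moment_recursion _ _); apply/funext => r.
apply: eq_bigr => pi _; congr (_ * _); apply: eq_bigr => C _.
rewrite fine_expectation; apply: eq_Rintegral => w _.
by rewrite prodr_const.
Qed.

(** The Hankel form of the moments at [c] is the expectation of the square of the
    polynomial in [X] with coefficients [c]. *)
Lemma moment_positive_rv X : finite_moments P X -> moment_positive (moment X).
Proof.
move=> hX N c.
have -> : \sum_(i < N) \sum_(j < N) c i * c j * moment X (i + j) =
    \int[P]_w (\sum_(i < N) c i * X w ^+ i) ^+ 2.
  transitivity (\int[P]_w (\sum_(i < N) \sum_(j < N) c i * c j * X w ^+ (i + j)%N)).
    rewrite Rintegral_sum => [|i _]; last by apply: integrable_rsum => j _;
      exact: finite_moments_powerZ.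
    apply: eq_bigr => i _; rewrite Rintegral_sum => [|j _];
      last exact: finite_moments_powerZ.
    by apply: eq_bigr => j _; rewrite RintegralZl//; exact: hX.
  apply: eq_Rintegral => w _; rewrite expr2 mulr_suml; apply: eq_bigr => i _.
  by rewrite mulr_sumr; apply: eq_bigr => j _; rewrite exprD; ring.
by apply: Rintegral_ge0 => w _; exact: sqr_ge0.
Qed.

Lemma moment_affine X a b n : finite_moments P X ->
  moment (fun w => a * X w + b) n =
  \sum_(i < n.+1) 'C(n, i)%:R * a ^+ i * b ^+ (n - i) * moment X i.
Proof.
move=> hX; transitivity (\int[P]_w
    (\sum_(i < n.+1) 'C(n, i)%:R * a ^+ i * b ^+ (n - i) * X w ^+ i)).
  apply: eq_Rintegral => w _; rewrite addrC exprDn; apply: eq_bigr => i _.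
  by rewrite exprMn -mulr_natl; ring.
rewrite Rintegral_sum => [|i _]; last exact: finite_moments_powerZ.
by apply: eq_bigr => i _; rewrite RintegralZl//; exact: hX.
Qed.

Lemma cumulant1 X : cumulant X 1 = moment X 1.
Proof.
have [m0 ->] := cumulant_recursion X.
by rewrite big_ord1 bin0 mul1r subnn m0 mulr1.
Qed.

(** On generating functions, f(t) becomes f(a t) e^(b t): cumulants are scaled by
    powers of [a], and only the first one is shifted. *)
Lemma moment_recursion_affine X a b : finite_moments P X ->
  moment_recursion (fun r => a ^+ r * cumulant X r + (r == 1%N)%:R * b)
    (moment (fun w => a * X w + b)).
Proof.
move=> hX; split=> [|n]; first exact: moment0.
have [_ mk] := cumulant_recursion X.
set k := cumulant X in mk *; set m := moment X in mk *.
pose m' := moment (fun w => a * X w + b).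
have m'E i : m' i = \sum_(l < i.+1) 'C(i, l)%:R * a ^+ l * b ^+ (i - l) * m l.
  exact: moment_affine.
(* In generating functions, E[X e^(t(aX+b))] = P'(a t) E[e^(t(aX+b))], where P is the
   exponential generating function of the cumulants of [X]. *)
have XE : \sum_(i < n.+1) 'C(n, i)%:R * a ^+ i * b ^+ (n - i) * m i.+1 =
    \sum_(j < n.+1) 'C(n, j)%:R * (a ^+ j * k j.+1) * m' (n - j)%N.
  transitivity (\sum_(i < n.+1) \sum_(j < n.+1 | (j <= i)%N)
     'C(n, i)%:R * a ^+ i * b ^+ (n - i) * ('C(i, j)%:R * k j.+1 * m (i - j)%N)).
    apply: eq_bigr => i _; rewrite mk mulr_sumr.
    rewrite (big_ord_widen n.+1 (fun j => 'C(n, i)%:R * a ^+ i * b ^+ (n - i) *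
      ('C(i, j)%:R * k j.+1 * m (i - j)%N))) ?ltn_ord//.
  rewrite (exchange_big_dep predT)//=; apply: eq_bigr => j _.
  have jn : (j <= n)%N by rewrite -ltnS.
  rewrite m'E mulr_sumr.
  transitivity (\sum_(j <= i < n.+1) 'C(n, i)%:R * a ^+ i * b ^+ (n - i) *
     ('C(i, j)%:R * k j.+1 * m (i - j)%N)).
    by rewrite big_geq_mkord.
  rewrite -{1}[nat_of_ord j]add0n big_addn big_mkord subSn//.
  apply: eq_bigr => l _.
  have jn' : (l <= n - j)%N by rewrite -ltnS.
  have ln : (l + j <= n)%N by rewrite addnC -leq_subRL.
  rewrite addnK -subnDA [(j + l)%N]addnC exprD.
  have -> : 'C(n, l + j)%:R = n`!%:R / ((l + j)`!%:R * (n - j - l)`!%:R) :> R.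
    by rewrite natr_bin// addnC subnDA.
  rewrite (natr_bin _ jn) (natr_bin _ jn') (natr_bin _ (leq_addl l j)) addnK.
  have f0 i : i`!%:R != 0 :> R by rewrite pnatr_eq0 -lt0n fact_gt0.
  by field; rewrite !f0.
transitivity (a * (\sum_(i < n.+1) 'C(n, i)%:R * a ^+ i * b ^+ (n - i) * m i.+1)
    + b * m' n).
  transitivity (\int[P]_w (\sum_(i < n.+1) 'C(n, i)%:R * a ^+ i * b ^+ (n - i) *
      (a * X w ^+ i.+1 + b * X w ^+ i))).
    apply: eq_Rintegral => w _; rewrite exprS [in X in _ * X]addrC exprDn mulr_sumr.
    by apply: eq_bigr => i _; rewrite exprMn exprS -mulr_natl; ring.
  have hXi c i := finite_moments_powerZ c i hX.
  rewrite Rintegral_sum => [|i _].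
    rewrite m'E !mulr_sumr -big_split /=; apply: eq_bigr => i _.
    rewrite RintegralZl//.
      rewrite RintegralD//.
      rewrite !RintegralZl//; try exact: hX.
      by rewrite /m /moment; ring.
    by rewrite (_ : _ \o _ = (fun w => (a * X w ^+ i.+1)%:E + (b * X w ^+ i)%:E)%E);
      [exact: (integrableD _ (hXi a i.+1) (hXi b i))|apply/funext].
  set c := _ * _ ^+ _; rewrite (_ : _ \o _
    = (fun w => (c * a * X w ^+ i.+1)%:E + (c * b * X w ^+ i)%:E)%E).
    exact: (integrableD _ (hXi (c * a) i.+1) (hXi (c * b) i)).
  by apply/funext => w /=; rewrite -EFinD mulrDr !mulrA.
rewrite XE mulr_sumr.
have -> : b * m' n = \sum_(j < n.+1) 'C(n, j)%:R * ((j.+1 == 1%N)%:R * b) * m' (n - j)%N.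
  rewrite big_ord_recl /= bin0 subn0 !mul1r big1 ?addr0// => j _.
  by rewrite mul0r mulr0 mul0r.
rewrite -big_split; apply: eq_bigr => j _ /=.
by rewrite exprS -/(m' _); ring.
Qed.

End CumulantMultilinear.

(** * Spanning trees and sums over tuples *)

Section SpanningTreeOrdering.
Variables (R : realType) (A : finType) (L : wgraph R A).

Lemma Wmax_ge0 (I J : {mset A}%mset) : 0 <= Wmax L I J.
Proof.
rewrite /Wmax; case: ifP => // _; apply: bigmax_ge_id.
Qed.

(** The list is read from its last element, the root; each earlier element is attached
    to the multiset of those that come after it. *)
Fixpoint attach_weight (s : seq A) : R :=
  if s is b :: s' then
    if s' is [::] then 1 else Wmax L [mset b]%mset (seq_mset s') * attach_weight s'
  else 1.

Lemma attach_weight_ge0 s : 0 <= attach_weight s.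
Proof.
by elim: s => [|b [|c s] IH]//=; rewrite mulr_ge0// Wmax_ge0.
Qed.

Variables (I : finType) (f : I -> A).
Local Notation K := (Defs.induced L f).

Lemma wweight_le_Wmax (x y : I) (s : seq I) :
    [set x; y]%SET \in wedges K -> x \in s ->
  wweight K [set x; y]%SET <= Wmax L [mset f y]%mset (seq_mset (map f s)).
Proof.
rewrite inE /= /induced_weight imsetU1 imset_set1 => /andP[_ fxy] xs.
have fxs : f x \in seq_mset (map f s) by rewrite (perm_mem (perm_eq_seq_mset _)) map_f.
have [fxfy|nfxy] := eqVneq (f x) (f y).
  rewrite fxfy finset.setUid cards1 eqxx /Wmax; case: existsP => // -[]; exists (f y).
  by rewrite in_mset1 eqxx -fxfy.
move: fxy; rewrite cards2 nfxy /= => fxyL.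
have [w0 w1] := andP (wweight_itv fxyL).
rewrite /Wmax; case: ifP => // _.
rewrite finset.setUC.
apply: (@le_bigmax_cond _ _ _ 0 (f y, f x) (fun p : A * A => [&& p.1 \in [mset f y]%mset,
  p.2 \in seq_mset (map f s) & adj (wedges L) p.1 p.2])
  (fun p => wweight L [set p.1; p.2]%SET)) => /=.
by rewrite in_mset1 eqxx fxs /adj finset.setUC.
Qed.

Lemma connected_crossing (E : {set {set I}}) (s : seq I) x0 y0 :
    (forall x y, connect (adj E) x y) -> x0 \in s -> y0 \notin s ->
  exists x y, [/\ x \in s, y \notin s & [set x; y]%SET \in E].
Proof.
move=> connE x0s y0s; apply: contrapT => nocross.
suff cl : fingraph.closed (adj E) (mem s).
  by have := closed_connect cl (connE x0 y0); rewrite /= x0s (negbTE y0s).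
move=> x y xyE /=; apply/idP/idP => h.
  by apply: contraT => h'; case: nocross; exists x, y.
by apply: contraT => h'; case: nocross; exists y, x; rewrite finset.setUC.
Qed.

(** As long as a vertex is missing, connectivity provides an edge of [E] that leaves
    the explored set; its weight is at most the W between its new endpoint and that
    set.  The edges found in this way are distinct, and the remaining edges of [E] have
    weight at most 1. *)
Lemma connected_ordering (E : {set {set I}}) :
    E \subset wedges K -> (forall x y, connect (adj E) x y) -> (0 < #|I|)%N ->
  exists s : seq I, [/\ uniq s, size s = #|I| &
    \prod_(e in E) wweight K e <= attach_weight (map f s)].
Proof.
move=> EK connE I0.
have w01 e : e \in E -> 0 <= wweight K e <= 1.
  by move=> eE; apply: (@wweight_itv _ _ K); apply: (fintype.subsetP EK).
suff : forall k, (k < #|I|)%N -> exists s : seq I, [/\ uniq s, size s = k.+1 &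
    exists F : {set {set I}}, [/\ F \subset E, forall e, e \in F -> {subset e <= s} &
      \prod_(e in F) wweight K e <= attach_weight (map f s)]].
  move=> /(_ #|I|.-1); rewrite prednK// leqnn => /(_ isT)[s [us ss [F [FE _ Fs]]]].
  exists s; split => //; apply: le_trans Fs.
  rewrite (big_setID F) /= (finset.setIidPr FE) ler_piMr//.
    by apply: prodr_ge0 => e eF; case/andP: (w01 e (fintype.subsetP FE e eF)).
  by apply: prodr_ile1 => e; rewrite inE => /andP[_]; exact: w01.
elim=> [_|k IH kI].
  have [x0 _] : exists x0 : I, x0 \in I by apply/card_gt0P.
  exists [:: x0]; split => //; exists finset.set0; split.
  - exact: finset.sub0set.
  - by move=> e; rewrite inE.
  - by rewrite big_set0.
have [s [us ss [F [FE Fs Fw]]]] := IH (ltnW kI).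
have [x0 x0s] : exists x0, x0 \in s by case: s ss {us Fs Fw} => // x0 s _; exists x0;
  rewrite inE eqxx.
have [y0 y0s] : exists y0, y0 \notin s.
  apply: contrapT => h; have sI : {subset I <= s}.
    by move=> y _; apply: contraT => ys; case: h; exists y.
  have := uniq_leq_size (enum_uniq I) (fun y _ => sI y isT).
  by rewrite -cardE ss leqNgt kI.
have [x [y [xs ys xyE]]] := connected_crossing connE x0s y0s.
exists (y :: s); split => /=; [by rewrite ys|by rewrite ss|].
have yF : [set x; y]%SET \notin F.
  by apply: contra ys => /Fs; apply; rewrite !inE eqxx orbT.
exists ([set x; y]%SET |: F)%SET; split.
- by rewrite finset.subUset finset.sub1set xyE.
- move=> e; rewrite !inE => /predU1P[-> z|/Fs h z /h zs]; last by rewrite inE zs orbT.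
  by rewrite !inE => /orP[/eqP ->|->//]; rewrite xs orbT.
rewrite big_setU1//=; case: s xs Fw {IH us ss Fs x0s y0s ys} => // c s xs Fw.
have [F0 _] := andP (w01 _ xyE).
apply: ler_pM => //.
  by apply: prodr_ge0 => e eF; case/andP: (w01 e (fintype.subsetP FE e eF)).
rewrite [c :: s in X in _ <= Wmax _ _ X]/=; apply: (@wweight_le_Wmax x y (c :: s)) => //.
exact: (fintype.subsetP EK).
Qed.

End SpanningTreeOrdering.

Section DependencySum.
Variables (R : realType) (A : finType) (L : wgraph R A) (Psi : {mset A}%mset -> R).
Hypothesis Psi_gt0 : forall B, B != mset0 -> 0 < Psi B.

(** The order of exploration depends on the tree; the sum over all orders does not. *)
Lemma max_spanning_weight_le r (al : r.-tuple A) : (0 < r)%N ->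
  max_spanning_weight (Defs.induced L (tnth al)) <=
  \sum_(si : r.-tuple 'I_r | uniq si) attach_weight L (map (tnth al) si).
Proof.
move=> r0; apply: bigmax_le => [|E /asboolP[EK connE _]].
  by apply: sumr_ge0 => si _; exact: attach_weight_ge0.
have [|s [us ss Es]] := connected_ordering EK connE; first by rewrite card_ord.
rewrite card_ord in ss; pose t : r.-tuple 'I_r := tcast ss (in_tuple s).
have tE : t = s :> seq _ by rewrite val_tcast.
rewrite (bigD1 t) /= ?tE//; apply: le_trans Es _.
by rewrite lerDl sumr_ge0// => si _; exact: attach_weight_ge0.
Qed.

Let attach_sum r := \sum_(be : r.-tuple A) Psi (seq_mset be) * attach_weight L be.

Lemma seq_mset_neq0 r (t : r.+1.-tuple A) : seq_mset t != mset0.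
Proof.
case: t => -[|a t] // st; apply/eqP => h; have := in_mset0 a.
by rewrite -h (perm_mem (perm_eq_seq_mset _)) inE eqxx.
Qed.

Lemma attach_sum1 : attach_sum 1 = Rsum Psi.
Proof.
rewrite /attach_sum sum_tuple_cons; apply: eq_bigr => a _.
rewrite (big_pred1 [tuple]) => [|t]; last by apply/esym/eqP; exact: tuple0.
rewrite mulr1; congr Psi; apply/msetP => b.
by rewrite mset_seqE msetnE /= addn0 eq_sym.
Qed.

(** The sum over the element attached last is the one that defines [Tmax]. *)
Lemma attach_sumS r : attach_sum r.+2 <= Tmax Psi L r.+1 * attach_sum r.+1.
Proof.
rewrite {1}/attach_sum sum_tuple_cons exchange_big /= /attach_sum mulr_sumr.
apply: ler_sum => t _; have P0 := Psi_gt0 (seq_mset_neq0 t).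
rewrite mulrA; apply: le_trans (_ : (\sum_b Wmax L [mset b]%mset (seq_mset t) *
    (Psi (b +` seq_mset t)%mset / Psi (seq_mset t))) * Psi (seq_mset t)
      * attach_weight L t <= _).
  rewrite -mulrA mulr_suml le_eqVlt; apply/orP; left; apply/eqP; apply: eq_bigr => b _.
  rewrite mset_cons; case: t P0 => -[|c t] // st P0 /=.
  by field; rewrite gt_eqF.
rewrite ler_wpM2r ?attach_weight_ge0// ler_wpM2r ?(ltW P0)//.
exact: (le_bigmax 0 (fun t : r.+1.-tuple A => \sum_b Wmax L [mset b]%mset (seq_mset t) *
    (Psi (b +` seq_mset t)%mset / Psi (seq_mset t))) t).
Qed.

Lemma Tmax_ge0 l : 0 <= Tmax Psi L l.
Proof. exact: bigmax_ge_id. Qed.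

Lemma Rsum_ge0 : 0 <= Rsum Psi.
Proof.
apply: sumr_ge0 => a _; apply/ltW/Psi_gt0; apply/eqP => h; have := in_mset0 a.
by rewrite -h in_mset1 eqxx.
Qed.

Lemma attach_sum_le r : attach_sum r.+1 <= Rsum Psi * \prod_(l < r) Tmax Psi L l.+1.
Proof.
elim: r => [|r IH]; first by rewrite big_ord0 mulr1 attach_sum1.
apply: le_trans (attach_sumS r) _.
by rewrite big_ord_recr /= mulrA [leRHS]mulrC ler_wpM2l// Tmax_ge0.
Qed.

Definition orderings r := #|[set si : r.-tuple 'I_r | uniq si]%SET|.

(** For a fixed order of attachment, renumbering the tuples along that order is a
    bijection which leaves [Psi] of the underlying multiset unchanged, so all orders
    contribute equally. *)
Lemma dependency_sum_le r :
  \sum_(al : r.+1.-tuple A) Psi (seq_mset al) *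
     max_spanning_weight (Defs.induced L (tnth al)) <=
  (orderings r.+1)%:R * (Rsum Psi * \prod_(l < r) Tmax Psi L l.+1).
Proof.
apply: (@le_trans _ _ (\sum_(si : r.+1.-tuple 'I_r.+1 | uniq si) attach_sum r.+1)).
  rewrite (@le_trans _ _ (\sum_(al : r.+1.-tuple A) \sum_(si : r.+1.-tuple 'I_r.+1 |
    uniq si)
     Psi (seq_mset al) * attach_weight L (map (tnth al) si)))//.
    apply: ler_sum => al _; rewrite -mulr_sumr ler_wpM2l ?max_spanning_weight_le//.
    by rewrite ltW// Psi_gt0// seq_mset_neq0.
  rewrite exchange_big /= le_eqVlt; apply/orP; left; apply/eqP; apply: eq_bigr => si us.
  have siT i : i \in si.
    have [|_ h] := uniq_min_size us (fun i (_ : i \in val si) => mem_enum 'I_r.+1 i).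
      by rewrite size_enum_ord size_tuple.
    by rewrite h mem_enum.
  rewrite /attach_sum [RHS](reindex_inj (h := fun al : r.+1.-tuple A
    => [tuple of map (tnth al) si])) /=.
    apply: eq_bigr => al _; congr (Psi _ * _); apply/eq_seq_msetP.
    rewrite -{1}(map_tnth_enum al) perm_map// uniq_perm ?enum_uniq// => i.
    by rewrite mem_enum siT.
  move=> al be /(congr1 val) /= /eq_in_map h; apply: eq_from_tnth => i; exact: h.
rewrite sumr_const -[leLHS]mulr_natl /orderings cardsE.
by rewrite ler_wpM2l// attach_sum_le.
Qed.

End DependencySum.

(** * Taylor expansion of the cosine *)

Section CosTaylor.
Variable R : realType.
Implicit Types (b x y : R).

Lemma le_antiderivative (f g f' g' : R -> R) x : 0 <= x ->
    (forall t, is_derive t (1 : R) f (f' t)) -> (forall t, is_derive t (1 : R) g (g' t)) ->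
    (forall t, 0 <= t -> f' t <= g' t) -> f 0 <= g 0 -> f x <= g x.
Proof.
move=> x0 df dg fg' fg0.
have dh (t : R) : is_derive t (1 : R) (g - f) (g' t - f' t) by exact: is_deriveB.
suff h : (g - f) 0 <= (g - f) x by move: h; rewrite !fctE; lra.
apply: (@ger0_derive1_le_cc _ (g - f) 0 x) => //.
- move=> t; rewrite in_itv /= => /andP[t0 _]; rewrite derive1E.
  by rewrite derive_val subr_ge0 fg'// ltW.
- by apply: derivable_within_continuous => t _; exact: ex_derive.
- by rewrite in_itv /= lexx x0.
- by rewrite in_itv /= lexx x0.
Qed.

Definition cos_taylor b n x : R :=
  \sum_(k < n) cos (b + k%:R * (pi / 2)) / k`!%:R * x ^+ k.

Lemma is_derive_cos_taylor b n y t :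
  is_derive t (1 : R) (fun t => cos_taylor b n.+1 (y * t))
    (y * cos_taylor (b + pi / 2) n (y * t)).
Proof.
pose p : {poly R} := \poly_(k < n.+1) (cos (b + k%:R * (pi / 2)) / k`!%:R * y ^+ k).
have pE u : cos_taylor b n.+1 (y * u) = p.[u].
  by rewrite horner_poly; apply: eq_bigr => k _; rewrite exprMn [LHS]mulrA.
rewrite (_ : (fun t => _) = horner p); last exact/funext.
apply: is_derive_eq.
have -> : p^`() = \poly_(k < n) (y * (cos (b + pi / 2 + k%:R * (pi / 2)) / k`!%:R
  * y ^+ k)).
  apply/polyP => k; rewrite coef_deriv !coef_poly ltnS; case: ifP => _;
    last by rewrite mul0rn.
  have -> : b + k.+1%:R * (pi / 2) = b + pi / 2 + k%:R * (pi / 2) by rewrite -natr1; ring.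
  rewrite -[LHS]mulr_natr factS natrM exprS.
  by field; rewrite !pnatr_eq0 -lt0n fact_gt0 addrC natr1 pnatr_eq0.
rewrite horner_poly mulr_sumr; apply: eq_bigr => k _.
by rewrite exprMn; ring.
Qed.

(** Along the segment from 0 to [y], the remainder of order n + 1 with phase [b] has as
    derivative [y] times the remainder of order n with phase b + pi / 2.  Letting the
    phase vary treats sine and cosine together in one induction. *)
Lemma cos_taylor_le b n y : `|cos (b + y) - cos_taylor b n y| <= `|y| ^+ n / n`!%:R.
Proof.
suff h t : 0 <= t -> `|cos (b + y * t) - cos_taylor b n (y * t)| <= (`|y| * t) ^+ n /
  n`!%:R.
  by have := h 1 ler01; rewrite !mulr1.
elim: n b t => [|n IH] b t t0.
  by rewrite /cos_taylor big_ord0 subr0 expr0 divr1 cos_max.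
have ct0 : cos_taylor b n.+1 (y * 0) = cos b.
  by rewrite /cos_taylor mulr0 big_ord_recl mul0r addr0 divr1 mulr1 big1 ?addr0// => k _;
    rewrite expr0n /= mulr0.
pose f u := cos (b + y * u) - cos_taylor b n.+1 (y * u).
pose f' u := y * (cos (b + pi / 2 + y * u) - cos_taylor (b + pi / 2) n (y * u)).
have df (u : R) : is_derive u (1 : R) f (f' u).
  rewrite /f /f' mulrBr; apply: is_deriveB; last exact: is_derive_cos_taylor.
  have d1 : is_derive u (1 : R) (fun u => b + y * u) y.
    by apply: is_derive_eq; rewrite /GRing.scale /=; ring.
  have d2 := @is_derive1_comp _ cos (fun u => b + y * u) u _ _ (is_derive_cos _) d1.
  apply: (is_derive_eq d2).
  by rewrite addrAC cosDpihalf /GRing.scale /=; ring.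
pose g u := (`|y| * u) ^+ n.+1 / n.+1`!%:R.
pose g' u := `|y| * ((`|y| * u) ^+ n / n`!%:R).
have dg (u : R) : is_derive u (1 : R) g (g' u).
  rewrite /g /g'.
  have -> : (fun u => (`|y| * u) ^+ n.+1 / n.+1`!%:R)
    = horner ((`|y| ^+ n.+1 / n.+1`!%:R) *: 'X^(n.+1)).
    by apply/funext => v; rewrite hornerZ hornerXn exprMn mulrAC.
  apply: is_derive_eq; rewrite derivZ derivXn hornerZ hornerMn hornerXn /=
    factS natrM exprMn exprS.
  rewrite -[_ *+ n.+1]mulr_natr.
  by field; rewrite !pnatr_eq0 -lt0n fact_gt0 addrC natr1 pnatr_eq0.
have f0 : f 0 = 0 by rewrite /f ct0 mulr0 addr0 subrr.
have g0 : g 0 = 0 by rewrite /g mulr0 expr0n mul0r.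
have f'g' u : 0 <= u -> `|f' u| <= g' u.
  by move=> u0; rewrite /f' /g' normrM ler_wpM2l// IH.
rewrite -/(f t) -/(g t) ler_norml lerNl; apply/andP; split.
  apply: (@le_antiderivative (- f) g (fun u => - f' u) g') => //.
  - by move=> u u0; have := f'g' u u0; rewrite ler_norml => /andP[]; lra.
  - by rewrite !fctE f0 g0 oppr0.
apply: (@le_antiderivative f g f' g') => //; last by rewrite f0 g0.
by move=> u u0; have := f'g' u u0; rewrite ler_norml => /andP[].
Qed.

End CosTaylor.

(** * Expectations of trigonometric polynomials *)

Inductive trig_poly (R : realType) : (R -> R) -> Prop :=
| trig_cos a b : trig_poly (fun x => cos (b + a * x))
| trig_add f g : trig_poly f -> trig_poly g -> trig_poly (fun x => f x + g x)
| trig_scale c f : trig_poly f -> trig_poly (fun x => c * f x).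

Section TrigPoly.
Variable R : realType.
Implicit Types f g : R -> R.

Lemma trig_poly_cst c : @trig_poly R (fun=> c).
Proof.
rewrite (_ : (fun=> c) = (fun x => c * cos (0 + 0 * x))).
  exact/trig_scale/trig_cos.
by apply/funext => x; rewrite mul0r addr0 cos0 mulr1.
Qed.

Lemma trig_polyM f g : trig_poly f -> trig_poly g -> trig_poly (fun x => f x * g x).
Proof.
move=> tf; elim: tf g => {f} [a b|f1 f2 _ IH1 _ IH2|c f _ IH] g tg.
- elim: tg => {g} [a' b'|g1 g2 _ IH1 _ IH2|c g _ IH].
  + rewrite (_ : (fun x => _) = (fun x => 2^-1
      * (cos (b + b' + (a + a') * x) + cos (b - b' + (a - a') * x)))).
      by apply: trig_scale; apply: trig_add; exact: trig_cos.
    have key u v : cos u * cos v = 2^-1 * (cos (u + v) + cos (u - v)) :> R.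
      by rewrite cosD cosB; field.
    by apply/funext => x; rewrite key; congr (_ * (cos _ + cos _)); ring.
  + rewrite (_ : (fun x => _) = (fun x => cos (b + a * x) * g1 x + cos (b + a * x) * g2 x)).
      exact: trig_add.
    by apply/funext => x; rewrite mulrDr.
  + rewrite (_ : (fun x => _) = (fun x => c * (cos (b + a * x) * g x))).
      exact: trig_scale.
    by apply/funext => x; rewrite mulrCA.
- rewrite (_ : (fun x => _) = (fun x => f1 x * g x + f2 x * g x)).
    by apply: trig_add; [exact: IH1|exact: IH2].
  by apply/funext => x; rewrite mulrDl.
- rewrite (_ : (fun x => _) = (fun x => c * (f x * g x))).
    by apply: trig_scale; exact: IH.
  by apply/funext => x; rewrite mulrA.
Qed.

Lemma trig_polyX f n : trig_poly f -> trig_poly (fun x => f x ^+ n).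
Proof.
move=> tf; elim: n => [|n IH]; first exact: trig_poly_cst.
by rewrite (_ : (fun x => _) = (fun x => f x * f x ^+ n));
  [exact: trig_polyM|apply/funext => x; rewrite exprS].
Qed.

Lemma trig_poly_bounded f : trig_poly f -> exists M, forall x, `|f x| <= M.
Proof.
elim=> {f} [a b|f g _ [M hM] _ [N hN]|c f _ [M hM]].
- by exists 1 => x; exact: cos_max.
- by exists (M + N) => x; rewrite (le_trans (ler_normD _ _))// lerD.
- by exists (`|c| * M) => x; rewrite normrM ler_wpM2l.
Qed.

Lemma trig_poly_measurable f : trig_poly f -> measurable_fun setT f.
Proof.
elim=> {f} [a b|f g _ mf _ mg|c f _ mf].
- apply: (@measurableT_comp _ _ _ _ _ _ cos); first by apply: continuous_measurable_fun;
    exact: continuous_cos.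
  by apply: measurable_funD => //; exact: measurable_funM.
- exact: measurable_funD.
- exact: measurable_funM.
Qed.

End TrigPoly.

Section TrigExpectation.
Context d (T : measurableType d) (R : realType) (P : probability T R).
Variable Z : T -> R.
Hypothesis mZ : measurable_fun setT Z.

Lemma trig_poly_integrable (g : R -> R) : trig_poly g ->
  P.-integrable setT (EFin \o (fun w => g (Z w))).
Proof.
move=> tg; have [M hM] := trig_poly_bounded tg.
apply: (@le_integrable_real _ _ _ _ _ (fun=> M)) => //.
  by apply: measurableT_comp => //; exact: trig_poly_measurable.
exact: finite_measure_integrable_cst.
Qed.

Hypothesis hZ : finite_moments P Z.

(** The truncation order is even so that the remainder is an honest moment of [Z],
    without absolute values. *)
Lemma expectation_cos_taylor a b K :
  `|\int[P]_w cos (b + a * Z w)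
    - \sum_(k < K.*2) cos (b + k%:R * (pi / 2)) / k`!%:R * a ^+ k * moment P Z k|
  <= a ^+ K.*2 / (K.*2)`!%:R * moment P Z K.*2.
Proof.
have iX c k := finite_moments_powerZ c k hZ.
have iS : P.-integrable setT (EFin \o (fun w => \sum_(k < K.*2)
    cos (b + k%:R * (pi / 2)) / k`!%:R * a ^+ k * Z w ^+ k)).
  by apply: integrable_rsum => k _; exact: iX.
have icos := trig_poly_integrable (trig_cos a b).
have -> : \sum_(k < K.*2) cos (b + k%:R * (pi / 2)) / k`!%:R * a ^+ k * moment P Z k =
    \int[P]_w \sum_(k < K.*2) cos (b + k%:R * (pi / 2)) / k`!%:R * a ^+ k * Z w ^+ k.
  rewrite Rintegral_sum => [|k _]; last exact: iX.
  by apply: eq_bigr => k _; rewrite RintegralZl//; exact: hZ.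
rewrite -RintegralB//.
apply: le_trans (le_normr_Rintegral _ _) _ => //.
  rewrite (_ : _ \o _ = (fun w => (cos (b + a * Z w))%:E
    - (\sum_(k < K.*2) cos (b + k%:R * (pi / 2)) / k`!%:R * a ^+ k * Z w ^+ k)%:E)%E).
    exact: (integrableB _ icos iS).
  by apply/funext => w.
rewrite -RintegralZl//; last exact: hZ.
apply: le_Rintegral => //.
- apply: integrable_norm => //.
  exact: (integrableB _ icos iS).
move=> w _; have := cos_taylor_le b K.*2 (a * Z w); rewrite /cos_taylor.
under eq_bigr => k _ do rewrite exprMn [_ / _ * _]mulrA.
have -> : `|a * Z w| ^+ K.*2 = a ^+ K.*2 * Z w ^+ K.*2.
  by rewrite -normrX ger0_norm ?exprn_even_ge0 ?odd_double// exprMn.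
by rewrite [X in _ <= X -> _]mulrAC.
Qed.

End TrigExpectation.

Section TrigConvergence.
Variable R : realType.
Context (d : nat -> measure_display) (T : forall n, measurableType (d n))
  (P : forall n, probability (T n) R) (Z : forall n, T n -> R).
Arguments Z : clear implicits.
Context d' (T' : measurableType d') (Q : probability T' R) (G : T' -> R).
Hypothesis Z_moments : \forall n \near \oo, finite_moments (P n) (Z n).
Hypothesis G_moments : finite_moments Q G.
Hypothesis cvg_moment : forall r, moment (P n) (Z n) r @[n --> \oo] --> moment Q G r.
Hypothesis G_entire : forall a : R, a ^+ n / n`!%:R * moment Q G n @[n --> \oo] --> 0.

(** No bound on the moments of [Z n] that is uniform in the order is available.  The
    truncation order K is therefore chosen first, from the limit law alone; both
    remainders are then small for large n, by convergence of the moment of order 2 K. *)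
Lemma cvg_expectation_cos a b :
  \int[P n]_w cos (b + a * Z n w) @[n --> \oo] --> \int[Q]_w cos (b + a * G w).
Proof.
apply/cvgrPdist_lt => eps eps0.
have cK : a ^+ K.*2 / (K.*2)`!%:R * moment Q G K.*2 @[K --> \oo] --> 0.
  apply: (@cvg_comp _ _ _ (fun K => K.*2) (fun n => a ^+ n / n`!%:R * moment Q G n) _ \oo);
    last exact: G_entire.
  by apply/cvgnyPge => K; exists K => // n /= Kn; rewrite (leq_trans Kn)// -addnn leq_addr.
have [K hK] : exists K, `|a ^+ K.*2 / (K.*2)`!%:R * moment Q G K.*2| < eps / 4.
  have e4 : 0 < eps / 4 by rewrite divr_gt0.
  have /cvgrPdist_lt/(_ _ e4) := cK.
  by move=> /filter_ex[K]; rewrite sub0r normrN => h; exists K.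
pose c k := cos (b + k%:R * (pi / 2)) / k`!%:R * a ^+ k.
pose S n := \sum_(k < K.*2) c k * moment (P n) (Z n) k.
pose S' := \sum_(k < K.*2) c k * moment Q G k.
have cS : S n @[n --> \oo] --> S'.
  by apply: cvg_sumr => k _; apply: cvgMl_tmp; exact: cvg_moment.
have e4 : 0 < eps / 4 by rewrite divr_gt0.
have cR : a ^+ K.*2 / (K.*2)`!%:R * moment (P n) (Z n) K.*2 @[n --> \oo] -->
    a ^+ K.*2 / (K.*2)`!%:R * moment Q G K.*2.
  by apply: cvgMl_tmp; exact: cvg_moment.
have H1 : \forall n \near \oo, `|S' - S n| < eps / 4 by move/cvgrPdist_lt: cS; exact.
have H2 : \forall n \near \oo,
    `|a ^+ K.*2 / (K.*2)`!%:R * moment (P n) (Z n) K.*2| < eps / 4.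
  exact: (cvgr_norm_lt _ cR).
near=> n.
have h1 : `|S' - S n| < eps / 4 by near: n.
have h2 : `|a ^+ K.*2 / (K.*2)`!%:R * moment (P n) (Z n) K.*2| < eps / 4 by near: n.
have hZ : finite_moments (P n) (Z n) by near: n.
have t1 := expectation_cos_taylor (finite_moments_measurable hZ) hZ a b K.
have t2 := expectation_cos_taylor (finite_moments_measurable G_moments) G_moments a b K.
rewrite -/(c _) -/(S n) in t1; rewrite -/S' in t2.
move: h1 h2 hK t1 t2.
set u := \int[P n]_w _; set v := \int[Q]_w _.
rewrite !ltr_norml !ler_norml.
set x := _ * moment (P n) (Z n) _; set y := _ * moment Q G _.
by move=> /andP[? ?] /andP[? ?] /andP[? ?] /andP[? ?] /andP[? ?]; apply/andP; split; lra.
Unshelve. all: by end_near. Qed.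

Lemma cvg_expectation_trig (g : R -> R) : trig_poly g ->
  \int[P n]_w g (Z n w) @[n --> \oo] --> \int[Q]_w g (G w).
Proof.
have mG := finite_moments_measurable G_moments.
elim=> {g} [a b|f g tf cf tg cg|c g tg cg]; first exact: cvg_expectation_cos.
- rewrite RintegralD//; try exact: trig_poly_integrable.
  apply: cvg_trans (cvgD cf cg); apply: near_eq_cvg; near=> n.
  have hZ : finite_moments (P n) (Z n) by near: n.
  by rewrite RintegralD//; apply: trig_poly_integrable => //;
    exact: finite_moments_measurable.
- rewrite RintegralZl//; try exact: trig_poly_integrable.
  apply: cvg_trans (cvgMl_tmp (a := c) cg); apply: near_eq_cvg; near=> n.
  have hZ : finite_moments (P n) (Z n) by near: n.
  by rewrite RintegralZl//; apply: trig_poly_integrable => //;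
    exact: finite_moments_measurable.
Unshelve. all: by end_near. Qed.

End TrigConvergence.

(** * Trigonometric approximation of half-lines *)

Section TrigStep.
Variable R : realType.

Lemma bernoulli_ge (x : R) n : -1 <= x -> 1 + n%:R * x <= (1 + x) ^+ n.
Proof.
move=> x1; elim: n => [|n IH]; first by rewrite mul0r addr0 expr0.
rewrite exprS; apply: le_trans (ler_wpM2l _ IH); last by lra.
rewrite -natr1; have : 0 <= n%:R * x ^+ 2 by rewrite mulr_ge0 ?sqr_ge0.
by nra.
Qed.

(** [steep_poly_small] and [steep_poly_large]: for large [m] the polynomial
    (1 - y^m)^(2^m) drops on [0, 1] from nearly 1 to nearly 0 around y = 1/2; both
    estimates are Bernoulli's inequality. *)
Lemma steep_poly_small (y : R) m : 0 <= y <= 1 ->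
  1 - (2 * y) ^+ m <= (1 - y ^+ m) ^+ (2 ^ m).
Proof.
move=> /andP[y0 y1]; have ym : y ^+ m <= 1 by rewrite exprn_ile1.
have := @bernoulli_ge (- y ^+ m) (2 ^ m); rewrite lerN2 => /(_ ym).
by rewrite natrX exprMn mulrN.
Qed.

Lemma steep_poly_large (y : R) m : 0 < y <= 1 ->
  (1 - y ^+ m) ^+ (2 ^ m) <= ((2 * y) ^+ m)^-1.
Proof.
move=> /andP[y0 y1]; have ym : y ^+ m <= 1 by rewrite exprn_ile1// ltW.
have ym0 : 0 < y ^+ m by rewrite exprn_gt0.
have y2 : 0 < (2 * y) ^+ m by rewrite exprn_gt0// mulr_gt0.
rewrite -[leRHS]mul1r ler_pdivlMr//.
apply: (@le_trans _ _ ((1 - y ^+ m) ^+ (2 ^ m) * (1 + y ^+ m) ^+ (2 ^ m))).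
  rewrite ler_wpM2l ?exprn_ge0 ?subr_ge0//.
  have := @bernoulli_ge (y ^+ m) (2 ^ m); rewrite natrX exprMn.
  by move=> h; apply: le_trans (h _); lra.
rewrite -exprMn exprn_ile1//; nra.
Qed.

(** Compose the steep polynomial with y = (1 + sin (t (z - x0))) / 2, where t is so small
    that y increases through 1/2 at z = x0 on a large window around x0.  Outside of the
    window periodicity spoils the approximation, but there the error term
    eps (1 + z^2) exceeds 1. *)
Lemma trig_step (x0 de eps : R) : 0 < de -> 0 < eps ->
  exists2 g : R -> R, trig_poly g &
    forall z, (z <= x0 - de)%R%:R - eps * (1 + z ^+ 2) <= g z /\
              g z <= (z <= x0 + de)%R%:R + eps * (1 + z ^+ 2).
Proof.
move=> de0 eps0.
(* Half-width of the window; a size of order (1 + x0^2) / eps is what [tail] requires. *)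
pose A := 2 * (de + 1 + 2 * (1 + x0 ^+ 2) / eps).
have w0 : 0 <= 2 * (1 + x0 ^+ 2) / eps.
  by rewrite divr_ge0 ?(ltW eps0)// mulr_ge0// addr_ge0// sqr_ge0.
have A0 : 0 < A by rewrite /A; lra.
have deA : de < A by rewrite /A; lra.
have tail z : A <= `|z - x0| -> 1 <= eps * (1 + z ^+ 2).
  move=> Az; have A1 : 1 <= A by rewrite /A; lra.
  have AA : A <= (z - x0) ^+ 2.
    by rewrite -real_normK ?num_real//; nra.
  have : 4 * (1 + x0 ^+ 2) <= eps * A.
    have -> : eps * A = 2 * (eps * de) + 2 * eps + 4 * (1 + x0 ^+ 2).
      by rewrite /A; field; rewrite gt_eqF.
    have := mulr_gt0 eps0 de0; lra.
  have : (z - x0) ^+ 2 <= 2 * (z ^+ 2 + x0 ^+ 2) by have := sqr_ge0 (z + x0); nra.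
  nra.
pose t := pi / 2 / A.
have pi0 := pi_gt0 R.
have t0 : 0 < t by rewrite /t !divr_gt0.
have tA : t * A = pi / 2 by rewrite /t divfK// gt_eqF.
pose s := sin (t * de).
have s0 : 0 < s.
  by apply: sin_gt0_pihalf; rewrite mulr_gt0//= -tA ltr_pM2l.
have [m hm] : exists m, ((1 + s) ^+ m)^-1 <= eps.
  have c0 : (1 + s)^-1 ^+ m @[m --> \oo] --> 0.
    have s1 : 1 < 1 + s by rewrite ltrDl.
    by apply: cvg_expr; rewrite ger0_norm ?invr_ge0 ?invf_lt1 ?(ltW (lt_trans ltr01 s1))
      ?(lt_trans ltr01 s1).
  have /cvgrPdist_lt/(_ _ eps0)/filter_ex[m] := c0.
  rewrite sub0r normrN => h; exists m; rewrite -exprVn.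
  by apply: le_trans (ler_norm _) (ltW h).
pose y z := (1 + sin (t * (z - x0))) / 2.
have y01 z : 0 <= y z <= 1.
  by have := sin_max (t * (z - x0)); rewrite ler_norml /y => /andP[? ?]; apply/andP; split;
    lra.
pose g z := (1 - y z ^+ m) ^+ (2 ^ m).
have g01 z : 0 <= g z <= 1.
  have [y0 y1] := andP (y01 z).
  have ym : y z ^+ m <= 1 by rewrite exprn_ile1.
  have ym0 : 0 <= y z ^+ m by rewrite exprn_ge0.
  by rewrite /g exprn_ge0 ?exprn_ile1 ?subr_ge0 ?lerBlDr ?lerDl.
exists g.
  rewrite /g; apply: trig_polyX.
  rewrite (_ : (fun z => _) = (fun z => 1 + (-1) * y z ^+ m)); last by apply/funext => z;
    rewrite mulN1r.
  apply: trig_add; first exact: trig_poly_cst.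
  apply: trig_scale; apply: trig_polyX.
  rewrite (_ : y = (fun z => 2^-1 + 2^-1 * cos ((- t * x0 - pi / 2) + t * z))).
    by apply: trig_add; [exact: trig_poly_cst|apply: trig_scale; exact: trig_cos].
  apply/funext => z; rewrite /y -[sin _]cosBpihalf.
  have -> : - t * x0 - pi / 2 + t * z = t * (z - x0) - pi / 2 by ring.
  by field.
have inwin z : `|z - x0| < A -> t * (z - x0) \in `[(- (pi / 2)), (pi / 2)].
  move=> /ltW; rewrite ler_norml => /andP[h1 h2]; rewrite in_itv /= -tA.
  by rewrite -mulrN !ler_pM2l// h1 h2.
have dewin : t * de \in `[(- (pi / 2)), (pi / 2)].
  rewrite in_itv /= -tA ler_pM2l// (ltW deA) andbT -mulrN ler_pM2l//; lra.
have ndewin : - (t * de) \in `[(- (pi / 2)), (pi / 2)].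
  rewrite in_itv /= lerN2 lerNl -tA -mulrN !ler_pM2l// (ltW deA) /=; lra.
have sin_le : {in `[(- (pi / 2)), (pi / 2)] &, {mono @sin R : x y / x <= y}}.
  by apply: le_mono_in => u v hu hv; rewrite ltr_sin.
move=> z; have [g0 g1] := andP (g01 z).
have e0 : 0 <= eps * (1 + z ^+ 2) by rewrite mulr_ge0 ?(ltW eps0)// addr_ge0// sqr_ge0.
have eps_le : eps <= eps * (1 + z ^+ 2) by rewrite ler_peMr ?(ltW eps0)// lerDl sqr_ge0.
have [Az|zA] := leP A `|z - x0|.
  have := tail _ Az.
  by split; [case: (z <= x0 - de)|case: (z <= x0 + de)]; rewrite /=; lra.
split.
  case: (leP z (x0 - de)) => zx /=; last by lra.
  suff : 1 - eps <= g z by lra.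
  apply: le_trans (steep_poly_small m (y01 z)); rewrite lerD2l lerN2.
  have sz : sin (t * (z - x0)) <= - s.
    by rewrite /s -sinN sin_le ?inwin// -mulrN ler_pM2l//; lra.
  have y2 : 2 * y z <= (1 + s)^-1.
    rewrite -[leRHS]mul1r ler_pdivlMr ?addr_gt0// /y.
    have -> : 2 * ((1 + sin (t * (z - x0))) / 2) = 1 + sin (t * (z - x0)) by field.
    have := sin_max (t * (z - x0)); rewrite ler_norml => /andP[? ?]; nra.
  apply: le_trans hm; rewrite -exprVn lerXn2r ?nnegrE ?invr_ge0 ?addr_ge0 ?(ltW s0)//.
  by have [? _] := andP (y01 z); rewrite mulr_ge0.
case: (leP z (x0 + de)) => zx /=; first by lra.
suff : g z <= eps by lra.
have sz : s <= sin (t * (z - x0)).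
  by rewrite /s sin_le ?inwin// ler_pM2l//; lra.
have y0 : 0 < y z by rewrite /y; lra.
have y20 : 0 < 2 * y z by rewrite mulr_gt0.
apply: le_trans (steep_poly_large m _) _; first by rewrite y0; case/andP: (y01 z).
apply: le_trans hm; rewrite lef_pV2 ?posrE ?exprn_gt0 ?addr_gt0//.
apply: lerXn2r; rewrite ?nnegrE ?addr_ge0 ?(ltW s0) ?(ltW y20)//.
by rewrite /y; lra.
Qed.

End TrigStep.

(** * Moments of the normal law *)

Section NormalMoments.
Variable R : realType.
Local Notation mu := (@lebesgue_measure R).
Local Notation N := (@normal_prob R 0 1).
Local Notation pdf := (@normal_pdf R 0 1).

(** The density agrees almost everywhere with the Radon-Nikodym derivative, whose change
    of variables formula applies. *)
Lemma ge0_integral_normal (f : R -> \bar R) :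
    (forall x, 0 <= f x)%E -> measurable_fun setT f ->
  (\int[N]_x f x = \int[mu]_x (f x * (pdf x)%:E))%E.
Proof.
move=> f0 mf; have Nmu : N `<< mu := normal_prob_dominates 0 1.
rewrite -(Radon_Nikodym_SigmaFinite.change_of_variables Nmu)//.
apply: ae_eq_integral => //.
- apply: emeasurable_funM => //.
  exact: measurable_int (Radon_Nikodym_SigmaFinite.f_integrable Nmu).
- by apply: emeasurable_funM => //; apply/measurable_EFinP; exact: measurable_normal_pdf.
have ae : ae_eq mu setT (Radon_Nikodym_SigmaFinite.f N mu) (fun x => (pdf x)%:E);
  last first.
  by apply: filterS ae => x /= h _; rewrite h.
apply: integral_ae_eq => //.
- exact: (Radon_Nikodym_SigmaFinite.f_integrable Nmu).
- apply/measurable_EFinP; exact: measurable_normal_pdf.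
by move=> E _ mE; exact: (esym (Radon_Nikodym_SigmaFinite.f_integral Nmu mE)).
Qed.

(** Completing the square turns the integrand into e^(t^2/2) times the normal density
    with mean [t], of total mass 1. *)
Lemma normal_mgf (t : R) :
  (\int[N]_x (expR (t * x))%:E = (expR (t ^+ 2 / 2))%:E)%E.
Proof.
have mexp : measurable_fun setT (fun x : R => expR (t * x)).
  by apply: measurableT_comp => //; exact: measurable_funM.
rewrite ge0_integral_normal; last 2 first.
- by move=> x; rewrite lee_fin expR_ge0.
- exact/measurable_EFinP.
transitivity (\int[mu]_x ((expR (t ^+ 2 / 2))%:E * (normal_pdf t 1 x)%:E))%E.
  apply: eq_integral => x _; rewrite -!EFinM !normal_pdfE ?oner_eq0//; congr EFin.
  rewrite mulrCA [RHS]mulrCA; congr (_ * _).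
  rewrite /normal_fun -!expRD; congr expR.
  by field.
rewrite ge0_integralZl//.
- by rewrite integral_normal_pdf mule1.
- apply/measurable_EFinP; exact: measurable_normal_pdf.
- by move=> x _; rewrite lee_fin normal_pdf_ge0.
Qed.

Lemma integrable_normal_exp (t : R) :
  N.-integrable setT (EFin \o (fun x => expR (t * x))).
Proof.
apply/integrableP; split.
  by apply/measurable_EFinP; apply: measurableT_comp => //; exact: measurable_funM.
under eq_integral => x _ do rewrite /= ger0_norm ?expR_ge0//.
by rewrite normal_mgf ltry.
Qed.

Lemma exp_partial_sum_le (x : R) n : 0 <= x ->
  \sum_(k < n) x ^+ k / k`!%:R <= expR x.
Proof.
move=> x0; rewrite -(big_mkord predT (fun k => x ^+ k / k`!%:R)).
apply: (@nondecreasing_cvgn_le _ (series (exp_coeff x))).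
  by apply: nondecreasing_series => k _ _; exact: exp_coeff_ge0.
exact: is_cvg_series_exp_coeff.
Qed.

Lemma exp_term_le (x : R) n : 0 <= x -> x ^+ n / n`!%:R <= expR x.
Proof.
move=> x0; apply: le_trans (exp_partial_sum_le n.+1 x0).
rewrite big_ord_recr /= lerDr sumr_ge0// => k _.
by rewrite divr_ge0// exprn_ge0.
Qed.

Let G (x : R) := x.

Lemma exp_norm_le (x : R) : expR `|x| <= expR x + expR (- x).
Proof. by case: (ger0P x) => _; rewrite ?lerDl ?lerDr expR_ge0. Qed.

Lemma integrable_normal_exp2 (t : R) :
  N.-integrable setT (EFin \o (fun x => expR (t * x) + expR (- (t * x)))).
Proof.
rewrite (_ : _ \o _ = (fun x => (expR (t * x))%:E + (expR (- t * x))%:E)%E).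
  exact: (integrableD _ (integrable_normal_exp t) (integrable_normal_exp (- t))).
by apply/funext => x /=; rewrite mulNr.
Qed.

Lemma normal_finite_moments : finite_moments N G.
Proof.
move=> n; apply: (@le_integrable_real _ _ _ N _ (fun x => n`!%:R
  * (expR (1 * x) + expR (- (1 * x))))).
- by apply: measurable_funX; exact: measurable_id.
- move=> x; rewrite mul1r normrX -ler_pdivrMl ?ltr0n ?fact_gt0// mulrC.
  exact: le_trans (exp_term_le n (normr_ge0 x)) (exp_norm_le x).
rewrite (_ : _ \o _ = (fun x => (n`!%:R)%:E * (expR (1 * x) + expR (- (1 * x)))%R%:E)%E);
  last first.
  by apply/funext.
by apply: integrableZl => //; exact: integrable_normal_exp2.
Qed.

Local Notation m := (moment N G).
Let u n := m n / n`!%:R.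

Lemma normal_moments_entire : entire_coef u.
Proof.
move=> B B0; exists (fine (\int[N]_x (expR (B * x) + expR (- (B * x)))%:E)%E) => n.
rewrite /u normrM normfV normr_nat -mulrA mulrC.
have -> : (n`!%:R)^-1 * B ^+ n * `|m n| = `|\int[N]_x ((n`!%:R)^-1 * B ^+ n * x ^+ n)|.
  rewrite RintegralZl//; last exact: normal_finite_moments.
  have c0 : 0 <= (n`!%:R)^-1 * B ^+ n by rewrite mulr_ge0 ?invr_ge0// exprn_ge0.
  by rewrite normrM (ger0_norm c0).
have ix := finite_moments_powerZ ((n`!%:R)^-1 * B ^+ n) n normal_finite_moments.
apply: le_trans (le_normr_Rintegral _ ix) _ => //.
apply: le_Rintegral => //.
- exact: integrable_norm.
- exact: integrable_normal_exp2.
move=> x _; apply: le_trans _ (exp_norm_le (B * x)).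
rewrite -mulrA -exprMn mulrC normrM normrX normfV normr_nat.
exact: exp_term_le.
Qed.

(** Integrate the exponential series term by term; e^(tx) + e^(-tx) dominates its
    partial sums. *)
Lemma normal_moment_series (t : R) : limn (pseries u t) = expR (t ^+ 2 / 2).
Proof.
apply: cvg_lim => //.
pose S K (x : R) := \sum_(k < K) (t * x) ^+ k / k`!%:R.
have mS K : measurable_fun setT (EFin \o S K).
  apply/measurable_EFinP/measurable_sum => k; apply: measurable_funM => //.
  by apply: measurable_funX; exact: measurable_funM.
have cS x : (EFin \o S n) x @[n --> \oo] --> (expR (t * x))%:E.
  apply: cvg_EFin; first exact: nearW.
  rewrite [X in X @ _](_ : _ = series (exp_coeff (t * x))).
    exact: is_cvg_series_exp_coeff.
  by apply/funext => n; rewrite /series /= big_mkord.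
have aeS : {ae N, forall x, setT x -> (EFin \o S n) x @[n --> \oo] --> (expR (t * x))%:E}.
  by apply: aeW => x _; exact: cS.
have Sle n x : (`|S n x| <= expR (t * x) + expR (- (t * x)))%R.
  apply: le_trans _ (exp_norm_le (t * x)); apply: le_trans (ler_norm_sum _ _ _) _.
  apply: le_trans _ (exp_partial_sum_le n (normr_ge0 (t * x))).
  by apply: ler_sum => k _; rewrite normrM normrX normfV normr_nat.
have aeSle : {ae N, forall x n, setT x ->
    (`|(EFin \o S n) x| <= (expR (t * x) + expR (- (t * x)))%:E)%E}.
  by apply: aeW => x n _; rewrite /= lee_fin; exact: Sle.
have [_ _] := @dominated_convergence _ _ _ N setT measurableT (fun K => EFin \o S K)
  (fun x => (expR (t * x))%:E) (fun x => (expR (t * x) + expR (- (t * x)))%:E) mS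
  (measurable_int _ (integrable_normal_exp t)) aeS
  (integrable_normal_exp2 t) aeSle.
rewrite normal_mgf => /fine_cvg; apply: cvg_trans; apply: near_eq_cvg; apply: nearW => K /=.
have iX c k := finite_moments_powerZ c k normal_finite_moments.
transitivity (\int[N]_x \sum_(k < K) (t ^+ k / k`!%:R) * x ^+ k).
  congr fine; apply: eq_integral => x _; congr EFin; apply: eq_bigr => k _.
  by rewrite exprMn mulrAC.
rewrite Rintegral_sum => [|k _]; last exact: iX.
rewrite /pseries /series /= big_mkord; apply: eq_bigr => k _.
by rewrite RintegralZl//; [rewrite /u /moment; ring|exact: normal_finite_moments].
Qed.

(** The value at 0 of a power series is its first coefficient, and the derivatives of
    equal sums are equal. *)
Lemma pseries_coef_inj (c c' : nat -> R) : entire_coef c -> entire_coef c' ->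
  (forall x, limn (pseries c x) = limn (pseries c' x)) -> c = c'.
Proof.
move=> hc hc' cc'; apply/funext => n; elim: n c c' hc hc' cc' => [|n IH] c c' hc hc' cc'.
  by rewrite -(limn_pseries0 c) cc' limn_pseries0.
have dcc' x : limn (pseries (pseries_diffs c) x) = limn (pseries (pseries_diffs c') x).
  have d1 := is_derive_pseries_entire x hc.
  have d2 := is_derive_pseries_entire x hc'.
  rewrite -(@derive_val _ _ _ _ _ _ _ d1) -(@derive_val _ _ _ _ _ _ _ d2).
  by congr ('D_1 _ x); apply/funext.
have := IH _ _ (entire_coef_diffs hc) (entire_coef_diffs hc') dcc'.
by rewrite /pseries_diffs => /mulfI; apply; rewrite pnatr_eq0.
Qed.

(** Compare coefficients in f' = x f for f = exp(x^2/2). *)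
Lemma normal_moments_rec n : m n.+1 = n%:R * m n.-1.
Proof.
have f0 k : k`!%:R != 0 :> R by rewrite pnatr_eq0 -lt0n fact_gt0.
have uE := normal_moments_entire.
pose shift k := if (k < 1)%N then 0 else u (k - 1)%N.
have shift_entire : entire_coef shift.
  move=> B B0; have [M hM] := uE _ B0; exists (M * B) => -[|k].
    rewrite /shift normr0 mul0r mulr_ge0//; apply: le_trans (hM 0%N).
    by rewrite mulr_ge0 ?exprn_ge0.
  by rewrite /shift subn1 /= exprSr mulrA ler_wpM2r.
have : pseries_diffs u = shift.
  apply: pseries_coef_inj => // [|x]; first exact: entire_coef_diffs.
  have -> : limn (pseries shift x) = x * expR (x ^+ 2 / 2).
    apply: cvg_lim => //; rewrite -normal_moment_series -{2}[x]expr1.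
    by apply: limn_pseries_shift; exact: cvg_pseries_entire.
  have d1 := is_derive_pseries_entire x uE.
  rewrite -(@derive_val _ _ _ _ _ _ _ d1).
  have -> : (fun x => limn (pseries u x)) = (fun x => expR (x ^+ 2 / 2)).
    by apply/funext => y; exact: normal_moment_series.
  have d2 : is_derive x (1 : R) (fun x => x ^+ 2 / 2) x.
    by apply: is_derive_eq; rewrite /GRing.scale /=; field.
  have d3 := @is_derive1_comp _ expR (fun x => x ^+ 2 / 2) x _ _ (is_derive_expR _) d2.
  by rewrite (@derive_val _ _ _ _ _ _ _ d3) mulrC.
move=> /(congr1 (fun f => f n)); rewrite /pseries_diffs /shift /u.
case: n => [|n] /=.
  by move=> h; rewrite mul0r; move: h; rewrite mul1r divr1.
rewrite subn1 /= !factS !natrM => h.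
have n0 k : k.+1%:R != 0 :> R by rewrite pnatr_eq0.
have key (a b c v w : R) : a != 0 -> b != 0 -> c != 0 ->
    a * (v / (a * (b * c))) = w / c -> v = b * w.
  move=> a0 b0 c0 e; have -> : v = a * (v / (a * (b * c))) * (b * c) by field;
    rewrite a0 b0 c0.
  by rewrite e; field.
exact: key h.
Qed.

Lemma normal_moment_recursion :
  moment_recursion (fun r => (r == 2)%:R) m.
Proof.
split=> [|n]; first exact: moment0.
rewrite normal_moments_rec; case: n => [|n].
  by rewrite mul0r big_ord1 mulr0 mul0r.
rewrite big_ord_recl mulr0 mul0r add0r big_ord_recl big1 ?addr0 => [|j _].
  by rewrite /= bin1 mulr1 subn1.
by rewrite mulr0 mul0r.
Qed.

Lemma normal_moments_small (a : R) : a ^+ n / n`!%:R * m n @[n --> \oo] --> 0.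
Proof.
have := cvg_series_cvg_0 (@cvg_pseries_entire _ _ a normal_moments_entire).
apply: cvg_trans; apply: near_eq_cvg; apply: nearW => n /=.
by rewrite /u; ring.
Qed.

End NormalMoments.

(** * Convergence in distribution from moments *)

Section StepExpectation.
Context d (T : measurableType d) (R : realType) (P : probability T R).
Variable Z : T -> R.
Hypothesis hZ : finite_moments P Z.
Let mZ := finite_moments_measurable hZ.

Lemma Rintegral_le_indic t :
  P.-integrable setT (EFin \o (fun w => ((Z w <= t)%R : bool)%:R : R)) /\
  \int[P]_w ((Z w <= t)%R : bool)%:R = fine (P (Z @^-1` `]-oo, t])).
Proof.
have mA : measurable (Z @^-1` `]-oo, t]).
  by rewrite -[X in measurable X]setTI; exact: mZ.
have E : (fun w => ((Z w <= t)%R : bool)%:R : R) = \1_(Z @^-1` `]-oo, t]).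
  apply/funext => w; rewrite indicE; congr ((nat_of_bool _)%:R); apply/idP/idP => h.
    by rewrite inE /= in_itv.
  by move: h; rewrite inE /= in_itv.
rewrite E; split; first exact: integrable_indic.
by rewrite /Rintegral integral_indic// setIT.
Qed.

Lemma step_expectation (g : R -> R) eps a b : trig_poly g ->
    (forall z, (z <= a)%R%:R - eps * (1 + z ^+ 2) <= g z /\
               g z <= (z <= b)%R%:R + eps * (1 + z ^+ 2)) ->
  fine (P (Z @^-1` `]-oo, a])) <= \int[P]_w g (Z w) + eps * (1 + moment P Z 2) /\
  \int[P]_w g (Z w) <= fine (P (Z @^-1` `]-oo, b])) + eps * (1 + moment P Z 2).
Proof.
move=> tg hg; have ig := trig_poly_integrable P mZ tg.
have [ia <-] := Rintegral_le_indic a.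
have [ib <-] := Rintegral_le_indic b.
have i1 : P.-integrable setT (EFin \o (fun w => 1 + Z w ^+ 2)).
  rewrite (_ : _ \o _ = (fun w => 1%:E + (Z w ^+ 2)%:E)%E); last by apply/funext.
  by apply: integrableD => //; exact: finite_measure_integrable_cst.
have i2 : P.-integrable setT (EFin \o (fun w => eps * (1 + Z w ^+ 2))).
  rewrite (_ : _ \o _ = (fun w => eps%:E * (1 + Z w ^+ 2)%:E)%E); last by apply/funext.
  exact: integrableZl.
have -> : eps * (1 + moment P Z 2) = \int[P]_w (eps * (1 + Z w ^+ 2)).
  rewrite RintegralZl// RintegralD//; last exact: hZ.
    by congr (_ * (_ + _)); rewrite -[LHS](moment0 P Z) /moment;
      under eq_Rintegral do rewrite expr0.
  exact: finite_measure_integrable_cst.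
rewrite -!RintegralD//; split; apply: le_Rintegral => //.
- exact: (integrableD _ ig i2).
- by move=> w _; have [h _] := hg (Z w); rewrite -lerBlDr.
- exact: (integrableD _ ib i2).
- by move=> w _; have [_ h] := hg (Z w).
Qed.

End StepExpectation.

Section MethodOfMoments.
Variable R : realType.
Context (d : nat -> measure_display) (T : forall n, measurableType (d n))
  (P : forall n, probability (T n) R) (Z : forall n, {RV (P n) >-> R}).
Arguments Z : clear implicits.
Local Notation N := (@normal_prob R 0 1).
Hypothesis Z_moments : \forall n \near \oo, finite_moments (P n) (Z n).
Hypothesis cvg_moment :
  forall r, moment (P n) (Z n) r @[n --> \oo] --> moment N (fun x : R => x) r.

(** At a continuity point [x], squeeze with two steps, centred at [x + de] and
    [x - de]: the first bounds the distribution functions of the [Z n] from above by the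
    normal one at [x + 2 de], the second from below by the normal one at [x - 2 de], up
    to errors governed by the second moments. *)
Theorem cvg_normal_of_moments : cvg_in_distribution Z N.
Proof.
move=> x Fx.
pose F t := fine (N `]-oo, t]).
pose p n t := fine (P n (Z n @^-1` `]-oo, t])).
have hN := @normal_finite_moments R.
have cF : F @ x --> F x.
  by apply: fine_cvg; rewrite fineK ?fin_num_measure//; exact: Fx.
suff cp : p n x @[n --> \oo] --> F x.
  have FE : (F x)%:E = N `]-oo, x]%classic by rewrite /F fineK ?fin_num_measure.
  suff : cdf (Z n) x @[n --> \oo] --> (F x)%:E by rewrite FE.
  apply: cvg_EFin; last exact: cp.
  by apply: nearW => n; rewrite /cdf fin_num_measure.
apply/cvgrPdist_lt => eps eps0.
have e4 : 0 < eps / 4 by rewrite divr_gt0.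
have e8 : 0 < eps / 8 by rewrite divr_gt0.
have e16 : 0 < eps / 16 by rewrite divr_gt0.
have [de de0 hde] : exists2 de, 0 < de & forall y, `|x - y| <= 2 * de -> `|F x
  - F y| < eps / 4.
  have /cvgrPdist_lt/(_ _ e4)[r /= r0 hr] := cF.
  exists (r / 4); first by rewrite divr_gt0.
  by move=> y xy; apply: hr; rewrite /ball /=; lra.
have [g1 tg1 hg1] := trig_step (x + de) de0 e16.
have [g2 tg2 hg2] := trig_step (x - de) de0 e16.
have c1 := cvg_expectation_trig Z_moments hN cvg_moment (@normal_moments_small R) tg1.
have c2 := cvg_expectation_trig Z_moments hN cvg_moment (@normal_moments_small R) tg2.
have m2N : moment N (fun x : R => x) 2 = 1.
  by rewrite normal_moments_rec mul1r moment0.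
have H1 : \forall n \near \oo, `|\int[N]_w g1 w - \int[P n]_w g1 (Z n w)| < eps / 8.
  by move/cvgrPdist_lt: c1; exact.
have H2 : \forall n \near \oo, `|\int[N]_w g2 w - \int[P n]_w g2 (Z n w)| < eps / 8.
  by move/cvgrPdist_lt: c2; exact.
have H3 : \forall n \near \oo, moment (P n) (Z n) 2 < 2.
  by have := @cvg_moment 2%N; rewrite m2N => /cvgr_lt; apply; rewrite ltr1n.
near=> n.
have hZ : finite_moments (P n) (Z n) by near: n.
have h1 : `|\int[N]_w g1 w - \int[P n]_w g1 (Z n w)| < eps / 8 by near: n.
have h2 : `|\int[N]_w g2 w - \int[P n]_w g2 (Z n w)| < eps / 8 by near: n.
have h3 : moment (P n) (Z n) 2 < 2 by near: n.
have [u1 _] := step_expectation hZ tg1 hg1.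
have [_ u2] := step_expectation hZ tg2 hg2.
have [_ u3] := step_expectation hN tg1 hg1.
have [u4 _] := step_expectation hN tg2 hg2.
rewrite m2N in u3 u4.
have f1 : `|F x - F (x + de + de)| < eps / 4.
  by apply: hde; rewrite ler_norml; apply/andP; split; lra.
have f2 : `|F x - F (x - de - de)| < eps / 4.
  by apply: hde; rewrite ler_norml; apply/andP; split; lra.
rewrite addrK in u1; rewrite subrK in u2.
rewrite -/(p n x) in u1; rewrite -/(p n x) in u2.
rewrite -/(F _) in u3; rewrite -/(F _) in u4.
have k1 : eps / 16 * (1 + moment (P n) (Z n) 2) <= eps / 16 * 3.
  by rewrite ler_wpM2l ?(ltW e16)//; lra.
move: h1 h2 f1 f2; rewrite !ltr_norml.
by move=> /andP[? ?] /andP[? ?] /andP[? ?] /andP[? ?]; apply/andP; split; lra.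
Unshelve. all: by end_near. Qed.

End MethodOfMoments.

(** * Cumulants of sums and standardization *)

Section CumulantBound.
Context d (T : measurableType d) (R : realType) (P : probability T R).
Variables (A : finType) (Psi : {mset A}%mset -> R) (L : wgraph R A).
Variables (C : nat -> R) (Y : A -> {RV P >-> R}).
Hypothesis Psi_gt0 : forall B, B != mset0 -> 0 < Psi B.
Hypothesis C_gt0 : forall r, (0 < r)%N -> 0 < C r.
Hypothesis L_wdg : weighted_dependency_graph Psi C L Y.
Hypothesis Y_moments : forall a, finite_moments P (Y a).

Lemma cumulant_sum_le r :
  `|cumulant P (fun w => \sum_a Y a w) r.+1| <=
  C r.+1 * ((orderings r.+1)%:R * (Rsum Psi * \prod_(l < r) Tmax Psi L l.+1)).
Proof.
rewrite /cumulant joint_cumulant_sum; last exact: Y_moments.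
apply: le_trans (ler_norm_sum _ _ _) _.
apply: le_trans (ler_wpM2l (ltW (C_gt0 (ltn0Sn r))) (dependency_sum_le L Psi_gt0 r)).
rewrite mulr_sumr; apply: ler_sum => al _; rewrite mulrA.
exact: L_wdg.
Qed.

Lemma cumulant_sum_le_power (D : nat -> R) Q r :
    (forall l, (0 < l)%N -> Tmax Psi L l <= D l * Q) -> 0 <= Q ->
  `|cumulant P (fun w => \sum_a Y a w) r.+1| <=
  C r.+1 * (orderings r.+1)%:R * (\prod_(l < r) `|D l.+1|) * (Rsum Psi * Q ^+ r).
Proof.
move=> TD Q0; apply: le_trans (cumulant_sum_le r) _.
have -> : C r.+1 * (orderings r.+1)%:R * (\prod_(l < r) `|D l.+1|) * (Rsum Psi * Q ^+ r) =
    C r.+1 * ((orderings r.+1)%:R * (Rsum Psi * \prod_(l < r) (`|D l.+1| * Q))).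
  by rewrite big_split /= prodr_const card_ord; ring.
rewrite ler_wpM2l ?(ltW (C_gt0 _))// ler_wpM2l// ler_wpM2l ?Rsum_ge0//.
apply: ler_prod => l _; rewrite Tmax_ge0 /=.
apply: le_trans (TD _ (ltn0Sn l)) _.
by rewrite ler_wpM2r// ler_norm.
Qed.

End CumulantBound.

Section Standardization.
Context d (T : measurableType d) (R : realType) (P : probability T R).
Variable X : {RV P >-> R}.
Hypothesis hX : finite_moments P X.
Hypothesis sg_gt0 : 0 < standard_deviation P X.
Local Notation sg := (standard_deviation P X).
Local Notation m1 := (moment P X 1).

Lemma expectation_moment1 : fine 'E_P[X] = m1.
Proof. by rewrite fine_expectation /moment; under [RHS]eq_Rintegral do rewrite expr1. Qed.

Lemma standardizeE :
  (standardize X : T -> R) = (fun w => sg^-1 * X w + - (sg^-1 * m1)).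
Proof.
apply/funext => w; rewrite /standardize expectation_moment1 -mulrBr.
by [].
Qed.

Definition standard_cumulant r : R :=
  sg^-1 ^+ r * cumulant P X r + (r == 1)%:R * - (sg^-1 * m1).

Lemma standard_recursion :
  moment_recursion standard_cumulant (moment P (standardize X)).
Proof. by rewrite standardizeE; exact: moment_recursion_affine. Qed.

Lemma standard_cumulant1 : standard_cumulant 1 = 0.
Proof. by rewrite /standard_cumulant cumulant1 expr1 mul1r subrr. Qed.

Lemma finite_moments_standardize : finite_moments P (standardize X).
Proof.
rewrite standardizeE; apply: finite_momentsD; last exact: finite_moments_cst.
by apply: finite_momentsM => //; exact: finite_moments_cst.
Qed.

(** The recursion identifies it with the second moment, since the first cumulant is 0. *)
Lemma standard_cumulant2 : standard_cumulant 2 = 1.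
Proof.
have [m0 mk] := standard_recursion.
have -> : standard_cumulant 2 = moment P (standardize X) 2.
  rewrite mk big_ord_recl big_ord1 /= standard_cumulant1 mulr0 mul0r add0r.
  by rewrite /bump /= binn mul1r subnn m0 mulr1.
have sg2 : sg ^+ 2 = fine 'V_P[X].
  by rewrite sqr_sqrtr// fine_ge0// variance_ge0.
have vE : fine 'V_P[X] = \int[P]_w (X w - m1) ^+ 2.
  rewrite /variance unlock fine_expectation; apply: eq_Rintegral => w _.
  by rewrite expectation_moment1.
rewrite /moment standardizeE.
have -> : \int[P]_w (sg^-1 * X w + - (sg^-1 * m1)) ^+ 2 = sg^-1 ^+ 2 * fine 'V_P[X].
  have i2 : P.-integrable setT (EFin \o (fun w => (X w - m1) ^+ 2)).
    exact: (finite_momentsD hX (finite_moments_cst P (- m1))).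
  rewrite vE -(RintegralZl _ measurableT i2).
  by apply: eq_Rintegral => w _; rewrite -exprMn mulrBr.
by rewrite -sg2 -exprMn mulVf ?gt_eqF// expr1n.
Qed.

Lemma standard_cumulantE r : (2 <= r)%N -> standard_cumulant r = cumulant P X r / sg ^+ r.
Proof.
move=> r2; rewrite /standard_cumulant (gtn_eqF r2) mul0r addr0 mulrC.
by rewrite exprVn.
Qed.

End Standardization.

(** * Asymptotic normality *)

Theorem theorem4p11 (R : realType)
    (d : nat -> measure_display) (Omega : forall n, measurableType (d n))
    (P : forall n, probability (Omega n) R)
    (N : nat -> nat) (Y : forall n, 'I_(N n) -> {RV (P n) >-> R})
    (Psi : forall n, {mset 'I_(N n)}%mset -> R)
    (L : forall n, wgraph R 'I_(N n))
    (C D Q : nat -> R) (s : nat)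
    (Y_moments : forall n, (0 < n)%N ->
      forall i : 'I_(N n), finite_moments (P n) (Y n i))
    (Psi_gt0 : forall n, (0 < n)%N ->
      forall B : {mset 'I_(N n)}%mset, B != mset0 -> 0 < Psi n B)
    (C_gt0 : forall r, (0 < r)%N -> 0 < C r)
    (L_wdg : forall n, (0 < n)%N ->
      weighted_dependency_graph (Psi n) C (L n) (Y n))
    (X := fun n => (\sum_(i < N n) Y n i) : {RV (P n) >-> R})
    (sigma := fun n => standard_deviation (P n) (X n))
    (sigma_gt0 : \forall n \near \oo, 0 < sigma n)
    (Q_gt0 : \forall n \near \oo, 0 < Q n)
    (s_ge3 : (3 <= s)%N)
    (T_le : forall r n, (0 < r)%N -> (0 < n)%N ->
      Tmax (Psi n) (L n) r <= D r * Q n)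
    (RQ_cvg0 :
      (Rsum (Psi n) / Q n) `^ s%:R^-1 * (Q n / sigma n) @[n --> \oo] --> 0) :
  cvg_in_distribution (fun n => standardize (X n)) (@normal_prob R 0 1).
Proof.
have sumE n : (X n : Omega n -> R) = (fun w => \sum_(i < N n) Y n i w).
  apply/funext => w; rewrite /X.
  by elim/big_rec2: _ => // i y1 y2 _ <-.
have X_moments n : (0 < n)%N -> finite_moments (P n) (X n).
  by move=> n0; rewrite sumE; apply: finite_moments_sum => i _; exact: Y_moments.
pose k n r := standard_cumulant (X n) r.
pose c r := C r * (orderings r)%:R * (\prod_(l < r.-1) `|D l.+1|).
pose a n := Rsum (Psi n) / Q n.
pose q n := Q n / sigma n.
have s0 : (0 < s)%N by rewrite (leq_trans _ s_ge3).
have c0 r : (0 < r)%N -> 0 <= c r.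
  move=> r0; rewrite /c; apply: mulr_ge0; last by apply: prodr_ge0 => l _.
  by rewrite mulr_ge0// ltW// C_gt0.
have good : \forall n \near \oo, [/\ (0 < n)%N, 0 < sigma n & 0 < Q n].
  by near=> n; split; near: n; [exact: nbhs_infty_gt|exact: sigma_gt0|exact: Q_gt0].
have a_ge0 n : (0 < n)%N -> 0 < Q n -> 0 <= a n.
  by move=> n0 Qn; rewrite divr_ge0 ?(ltW Qn)// Rsum_ge0// => B; exact: Psi_gt0.
have k_le n r : (0 < n)%N -> 0 < sigma n -> 0 < Q n -> (2 <= r)%N ->
    `|k n r| <= c r * (a n * q n ^+ r).
  move=> n0 sn Qn; case: r => // r r1.
  rewrite /k standard_cumulantE// normrM normfV normrX (gtr0_norm sn).
  rewrite ler_pdivrMr ?exprn_gt0//.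
  have -> : c r.+1 * (a n * q n ^+ r.+1) * sigma n ^+ r.+1 =
      c r.+1 * (Rsum (Psi n) * Q n ^+ r).
    rewrite /a /q expr_div_n exprS; field.
    by rewrite !gt_eqF// exprn_gt0.
  rewrite sumE; apply: (@cumulant_sum_le_power _ _ _ _ _ (Psi n) (L n)) => //.
  - exact: Psi_gt0.
  - exact: L_wdg.
  - by move=> i; exact: Y_moments.
  - by move=> l l0; exact: T_le.
  - exact: ltW.
have k2 : \forall n \near \oo, k n 2%N = 1.
  near=> n; have [n0 sn _] : [/\ (0 < n)%N, 0 < sigma n & 0 < Q n] by near: n.
  by apply: standard_cumulant2 => //; exact: X_moments.
have aq0 : a n * q n ^+ s @[n --> \oo] --> 0.
  have := cvg_comp _ _ RQ_cvg0 (@exprn_continuous R s 0).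
  rewrite expr0n gtn_eqF//=; apply: cvg_trans; apply: near_eq_cvg; near=> n.
  have [n0 sn Qn] : [/\ (0 < n)%N, 0 < sigma n & 0 < Q n] by near: n.
  have rootX : (a n `^ s%:R^-1) ^+ s = a n.
    by rewrite -powR_mulrn ?powR_ge0// -powRrM mulVf ?powRr1 ?a_ge0// pnatr_eq0 -lt0n.
  by rewrite /= exprMn -/(a n) rootX.
(* The case r = 2 of the bound reads 1 <= c_2 a q^2; if q > 1 then c_2 a q^2 <= c_2 a q^s,
   and the latter is eventually less than 1. *)
have q_le1 : \forall n \near \oo, 0 <= q n <= 1.
  have cs : \forall n \near \oo, c 2%N * (a n * q n ^+ s) < 1.
    have c2 : c 2%N * (a n * q n ^+ s) @[n --> \oo] --> 0.
      by rewrite -(mulr0 (c 2%N)); exact: cvgMl_tmp.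
    exact: (cvgr_lt _ c2 _ ltr01).
  near=> n; have [n0 sn Qn] : [/\ (0 < n)%N, 0 < sigma n & 0 < Q n] by near: n.
  have kn2 : k n 2%N = 1 by near: n.
  have csn : c 2%N * (a n * q n ^+ s) < 1 by near: n.
  have q0 : 0 < q n by rewrite divr_gt0.
  rewrite ltW//= leNgt; apply/negP => q1.
  have := k_le n 2%N n0 sn Qn isT; rewrite kn2 normr1 => h.
  have : c 2%N * (a n * q n ^+ 2) <= c 2%N * (a n * q n ^+ s).
    rewrite ler_wpM2l ?c0// ler_wpM2l ?a_ge0//.
    by rewrite ler_weXn2l ?(ltW q1)// (leq_trans _ s_ge3).
  by move=> /(le_trans h); rewrite leNgt csn.
have k_tail r : (s <= r)%N -> k n r @[n --> \oo] --> 0.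
  move=> sr; apply/norm_cvg0P.
  have cr0 : c r * (a n * q n ^+ s) @[n --> \oo] --> 0.
    by rewrite -(mulr0 (c r)); exact: cvgMl_tmp.
  apply: (squeeze_cvgr _ (cvg_cst 0) cr0); near=> n.
  have [n0 sn Qn] : [/\ (0 < n)%N, 0 < sigma n & 0 < Q n] by near: n.
  have /andP[q0 q1] : 0 <= q n <= 1 by near: n.
  have r2 : (2 <= r)%N by rewrite (leq_trans _ sr)// (leq_trans _ s_ge3).
  rewrite normr_ge0 /= (le_trans (k_le n r n0 sn Qn r2))//.
  rewrite ler_wpM2l ?c0 ?(leq_trans _ r2)// ler_wpM2l ?a_ge0//.
  exact: ler_wiXn2l.
have Z_moments : \forall n \near \oo, finite_moments (P n) (standardize (X n)).
  near=> n; have [n0 sn Qn] : [/\ (0 < n)%N, 0 < sigma n & 0 < Q n] by near: n.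
  by apply: finite_moments_standardize; exact: X_moments.
have mk : \forall n \near \oo, moment_recursion (k n) (moment (P n) (standardize (X n))).
  near=> n; have [n0 sn Qn] : [/\ (0 < n)%N, 0 < sigma n & 0 < Q n] by near: n.
  by apply: standard_recursion; exact: X_moments.
have k1 : \forall n \near \oo, k n 1%N = 0 by apply: nearW => n; exact: standard_cumulant1.
have m_pos : \forall n \near \oo, moment_positive (moment (P n) (standardize (X n))).
  by apply: filterS Z_moments => n; exact: moment_positive_rv.
have k3 := janson_cumulants mk m_pos k1 k2 k_tail.
apply: cvg_normal_of_moments Z_moments _.
apply: cvg_moments mk _ _ (normal_moment_recursion R) _ => -[|[|[|r]]]// _.
- by apply: cvg_near_cst.
- by apply: cvg_near_cst.
- exact: k3.
Unshelve. all: by end_near. Qed.
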